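(* Let $(M,\Omega)$ be a holomorphic symplectic manifold, let $\pi: M\to B$ be a holomorphic Lagrangian fibration, and let $S: B\to M$ be a smooth (i.e. $C^\infty$, not necessarily holomorphic) section of $\pi$. Then there exists a closed form $\eta\in\Lambda^{2,0}(B)+\Lambda^{1,1}(B)$ on $B$ such that $S$ is holomorphic Lagrangian with respect to the complex structure $I_\eta$ on $M$ induced by $\Omega+\pi^*\eta$; that is, $S: B\to (M,I_\eta)$ is a holomorphic map and its image $S(B)$ is a Lagrangian submanifold with respect to $\Omega+\pi^*\eta$.
   Context: A holomorphic symplectic manifold $(M,\Omega)$ is a complex manifold of complex dimension $2n$ with a closed holomorphic $(2,0)$-form $\Omega$ that is everywhere non-degenerate. A holomorphic Lagrangian fibration on it is a surjective holomorphic map $\pi: M\to B$ to a complex manifold $B$, with connected fibers, whose fibers are Lagrangian with respect to $\Omega$ (each fiber has dimension $n$ and $\Omega$ vanishes on its smooth locus). A c-symplectic form on a smooth manifold of real dimension $4n$ is a closed complex-valued 2-form $\Psi$ with $\Psi^{n+1}=0$ and $(\Psi\wedge\overline\Psi)^n$ nowhere zero. The complex structure $I_\Psi$ induced by $\Psi$ is the unique almost complex structure for which $\Psi$ is a non-degenerate form of Hodge type $(2,0)$; equivalently its $(0,1)$-tangent bundle is $\{v\in TM\otimes\mathbb{C} : \iota_v\Psi=0\}$. It is integrable because $\Psi$ is closed. If $\eta$ is a closed complex-valued 2-form of Hodge type $(2,0)+(1,1)$ on $B$, then $\Omega+\pi^*\eta$ is a c-symplectic form on $M$, and $I_\eta$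 denotes the complex structure induced by it. The complex structure on $B$ is kept fixed. *)

(* Defs.v *)
From HB Require Import structures.
From mathcomp Require Import all_boot all_order all_algebra.
From mathcomp Require Import all_classical all_reals all_analysis.
From mathcomp Require Import complex.
Set Implicit Arguments.
Unset Strict Implicit.
Unset Printing Implicit Defensive.
Import Order.TTheory GRing.Theory Num.Theory.
Import numFieldNormedType.Exports.
Local Open Scope classical_set_scope.
Local Open Scope ring_scope.
Local Open Scope complex_scope.

(* The real normed space underlying C^n: (x, y) stands for x + i y. *)
Definition Cn (R : realType) (n : nat) : normedModType R :=
  ('rV[R]_n * 'rV[R]_n)%type.

Definition mulI (R : realType) (n : nat) (v : Cn R n) : Cn R n := (- v.2, v.1).

Fixpoint Ck_on (R : realType) (V W : normedModType R) (k : nat) (U : set V)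
    (f : V -> W) : Prop :=
  if k is k'.+1 then
    (forall x, U x -> differentiable f x) /\
    (forall v, Ck_on k' U (fun x => 'D_v f x))
  else forall x, U x -> {for x, continuous f}.

Definition smooth_on (R : realType) (V W : normedModType R) (U : set V)
  (f : V -> W) : Prop := forall k, Ck_on k U f.

(* A smooth map between open sets of C^n and C^m is holomorphic iff its real
   differential is C-linear (Cauchy-Riemann). *)
Definition holomorphic_on (R : realType) (n m : nat) (U : set (Cn R n))
    (f : Cn R n -> Cn R m) : Prop :=
  smooth_on U f /\ (forall p, U p -> forall v, 'd f p (mulI v) = mulI ('d f p v)).

Definition csmooth_on (R : realType) (V : normedModType R) (U : set V)
    (f : V -> R[i]) : Prop :=
  smooth_on U (fun p => complex.Re (f p)) /\
  smooth_on U (fun p => complex.Im (f p)).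

Definition cderive (R : realType) (V : normedModType R) (v : V)
    (f : V -> R[i]) (p : V) : R[i] :=
  'D_v (fun q => complex.Re (f q)) p +i* 'D_v (fun q => complex.Im (f q)) p.

(* [cmap] and [cinv] are total functions, constrained only on [cdom], [ccod]. *)
Record chart (R : realType) (n : nat) (M : topologicalType) := Chart {
  cdom : set M;
  ccod : set (Cn R n);
  cmap : M -> Cn R n;
  cinv : Cn R n -> M;
  cdom_open : open cdom;
  ccod_open : open ccod;
  cmap_cod : forall x, cdom x -> ccod (cmap x);
  cinv_dom : forall p, ccod p -> cdom (cinv p);
  cmapK : forall x, cdom x -> cinv (cmap x) = x;
  cinvK : forall p, ccod p -> cmap (cinv p) = p;
  cmap_continuous : forall x, cdom x -> {for x, continuous cmap};
  cinv_continuous : forall p, ccod p -> {for p, continuous cinv} }.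

Record complexManifold (R : realType) (n : nat) := ComplexManifold {
  carrier :> topologicalType;
  carrier_hausdorff : hausdorff_space carrier;
  carrier_second_countable : @second_countable carrier;
  atlas : set (chart R n carrier);
  chart_at : carrier -> chart R n carrier;
  chart_at_atlas : forall x, atlas (chart_at x);
  chart_at_dom : forall x, cdom (chart_at x) x;
  atlas_holomorphic : forall c c', atlas c -> atlas c' ->
    holomorphic_on (ccod c `&` cinv c @^-1` cdom c') (cmap c' \o cinv c) }.

(* The real tangent space T_x M is identified with C^n by means of the chart
   [chart_at x].  As charts are holomorphic, the complex structure of M acts on
   every T_x M as [mulI]. *)

Section Maps.
Variables (R : realType) (n : nat) (M : complexManifold R n).

Definition smooth_from (d : nat) (W : set (Cn R d)) (g : Cn R d -> M) : Prop :=
  (forall p, W p -> {for p, continuous g}) /\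
  (forall c, atlas c -> smooth_on (W `&` g @^-1` cdom c) (cmap c \o g)).

(* The differential at p of a map g : C^d -> M, with values in T_(g p) M. *)
Definition pdiff (d : nat) (g : Cn R d -> M) (p : Cn R d) : Cn R d -> Cn R n :=
  'd (cmap (chart_at (g p)) \o g) p.

Definition smooth_map (m : nat) (B : complexManifold R m) (f : B -> M) : Prop :=
  forall c, atlas c -> smooth_from (ccod c) (f \o cinv c).

(* The differential T_x B -> T_(f x) M. *)
Definition mdiff (m : nat) (B : complexManifold R m) (f : B -> M) (x : B) :
    Cn R m -> Cn R n :=
  'd (cmap (chart_at (f x)) \o f \o cinv (chart_at x)) (cmap (chart_at x) x).

(* f is a holomorphic map B -> (M, I), where I is an almost complex structure
   on M and B carries its own complex structure. *)
Definition holomorphic_to (m : nat) (B : complexManifold R m)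
    (I : M -> Cn R n -> Cn R n) (f : B -> M) : Prop :=
  smooth_map f /\
  (forall x u, mdiff f x (mulI u) = I (f x) (mdiff f x u)).

Definition holomorphic_map (m : nat) (B : complexManifold R m) (f : B -> M) :
    Prop :=
  holomorphic_to (fun _ => @mulI R n) f.

(* g restricts to a diffeomorphism from the open set W of C^d onto a relatively
   open subset of N, so that N is, near the points of g(W), an embedded
   submanifold of real dimension 2d with tangent spaces the images of [pdiff g]. *)
Definition local_param (N : set M) (d : nat) (W : set (Cn R d))
    (g : Cn R d -> M) : Prop :=
  [/\ open W,
      smooth_from W g,
      (forall p q, W p -> W q -> g p = g q -> p = q),
      (forall p, W p -> injective (pdiff g p)) &
      (forall W', open W' -> W' `<=` W ->
         exists2 U : set M, open U & g @` W' = N `&` U)].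

Definition holomorphic_local_param (N : set M) (d : nat) (W : set (Cn R d))
    (g : Cn R d -> M) : Prop :=
  local_param N W g /\
  (forall p, W p -> forall u, pdiff g p (mulI u) = mulI (pdiff g p u)).

End Maps.

(* Complex-valued 2-tensor fields: [w x] takes two real tangent vectors at x. *)
Definition tensor2 (R : realType) (n : nat) (M : complexManifold R n) :=
  M -> Cn R n -> Cn R n -> R[i].

Section Forms.
Variables (R : realType) (n : nat) (M : complexManifold R n).
Implicit Types w : tensor2 M.

Definition ppullback (d : nat) (g : Cn R d -> M) w (p u v : Cn R d) : R[i] :=
  w (g p) (pdiff g p u) (pdiff g p v).

Definition pullback (m : nat) (B : complexManifold R m) (f : B -> M) w :
    tensor2 B :=
  fun x u v => w (f x) (mdiff f x u) (mdiff f x v).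

Definition coef w (c : chart R n M) (u v p : Cn R n) : R[i] :=
  ppullback (cinv c) w p u v.

Definition two_form w : Prop :=
  [/\ (forall x (a : R) u u' v,
         w x (a *: u + u') v = a%:C * w x u v + w x u' v),
      (forall x (a : R) u v v',
         w x u (a *: v + v') = a%:C * w x u v + w x u v'),
      (forall x u, w x u u = 0) &
      (forall c, atlas c -> forall u v, csmooth_on (ccod c) (coef w c u v))].

(* The exterior derivative is computed in charts, on constant vector fields. *)
Definition closed_form w : Prop :=
  forall c, atlas c -> forall p, ccod c p -> forall u v z,
    cderive u (coef w c v z) p - cderive v (coef w c u z) p
      + cderive z (coef w c u v) p = 0.

Definition nondegenerate w : Prop :=
  forall x u, (forall v, w x u v = 0) -> u = 0.

(* Hodge types with respect to an almost complex structure I, in terms of real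
   tangent vectors; [type20] says that the (0,1)-vectors u + i I(u) are in the
   kernel of the complexification of [w x]. *)
Definition type20 (I : M -> Cn R n -> Cn R n) w : Prop :=
  forall x u v, w x (I x u) v = 'i * w x u v.

Definition type11 (I : M -> Cn R n -> Cn R n) w : Prop :=
  forall x u v, w x (I x u) (I x v) = w x u v.

Definition type20_11 w : Prop :=
  exists a b : tensor2 M,
    [/\ two_form a, two_form b, type20 (fun _ => @mulI R n) a,
        type11 (fun _ => @mulI R n) b &
        forall x u v, w x u v = a x u v + b x u v].

(* For a (2,0)-form, degeneracy on real vectors is the same as degeneracy on
   (1,0)-vectors. *)
Definition holomorphic_symplectic w : Prop :=
  [/\ two_form w, closed_form w, type20 (fun _ => @mulI R n) w,
      (forall c, atlas c -> forall u v p, ccod c p -> forall z,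
         cderive (mulI z) (coef w c u v) p = 'i * cderive z (coef w c u v) p) &
      nondegenerate w].

(* Smoothness is that of the coefficients of I in the charts of M. *)
Definition almost_complex_structure (I : M -> Cn R n -> Cn R n) : Prop :=
  [/\ (forall x (a : R) u v, I x (a *: u + v) = a *: I x u + I x v),
      (forall x u, I x (I x u) = - u) &
      (forall c, atlas c -> forall u,
         smooth_on (ccod c) (fun p =>
           let x := cinv c p in
           'd (cmap c \o cinv (chart_at x)) (cmap (chart_at x) x)
             (I x (pdiff (cinv c) p u)) : Cn R n))].

(* I is the complex structure I_w induced by the c-symplectic form w. *)
Definition induced_structure w (I : M -> Cn R n -> Cn R n) : Prop :=
  [/\ almost_complex_structure I, type20 I w & nondegenerate w].

End Forms.

Section Lagrangian.
Variables (R : realType) (n : nat) (M : complexManifold R (2 * n)).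

(* The smooth locus of an analytic subset F consists of the points around which
   F has a holomorphic local parametrization; such an F is Lagrangian when it has
   dimension n and w vanishes on its tangent spaces at every smooth point. *)
Definition lagrangian_subvariety (w : tensor2 M) (F : set M) : Prop :=
  forall (d : nat) (W : set (Cn R d)) (g : Cn R d -> M),
    holomorphic_local_param F W g ->
    forall p, W p -> d = n /\ (forall u v, ppullback g w p u v = 0).

Definition lagrangian_submanifold (w : tensor2 M) (N : set M) : Prop :=
  (forall x, N x -> exists (W : set (Cn R n)) (g : Cn R n -> M),
     local_param N W g /\ (exists2 p, W p & g p = x)) /\
  (forall (W : set (Cn R n)) (g : Cn R n -> M), local_param N W g ->
     forall p, W p -> forall u v, ppullback g w p u v = 0).

Definition lagrangian_fibration (w : tensor2 M) (m : nat)
    (B : complexManifold R m) (f : M -> B) : Prop :=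
  [/\ holomorphic_map f,
      (forall b, exists x, f x = b),
      (forall b, connected (f @^-1` [set b])) &
      (forall b, lagrangian_subvariety w (f @^-1` [set b]))].

End Lagrangian.

(* Main.v *)
Require Import Defs.
From HB Require Import structures.
From mathcomp Require Import all_boot all_order all_algebra.
From mathcomp Require Import all_classical all_reals all_analysis.
From mathcomp Require Import complex.
From mathcomp Require Import ring lra.
Set Implicit Arguments.
Unset Strict Implicit.
Unset Printing Implicit Defensive.
Import Order.TTheory GRing.Theory Num.Theory.
Import numFieldNormedType.Exports.
Local Open Scope classical_set_scope.
Local Open Scope ring_scope.

(** The form is [eta = - S^* Omega].  It is closed, and it has no (0,2)-part
    because for [v] of type (0,1) the (1,0)-part of [dS v] is vertical, and the
    fibres are Lagrangian.  Since [pi o S = id], the pullback of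
    [Psi = Omega + pi^* eta] by [S] vanishes.

    What has to be controlled are the critical points of [pi].  Where the rank of
    [d pi] is locally maximal it is locally constant, so the fibre is a
    submanifold, hence Lagrangian of dimension n; there the Poisson bracket which
    [Omega] induces on functions pulled back from the base vanishes.  Such points
    are dense, so the bracket vanishes everywhere: a tangent vector which is
    [Omega]-orthogonal to [ker d pi] lies in [ker d pi].  This gives the
    nondegeneracy of [Psi], and the structure [I u = J u + h], where [h] is the
    vertical vector with [Omega(h, .) = i eta(d pi u, .) - eta(J d pi u, .)]. *)

(** The Lagrangian hypothesis speaks only of points where a fibre has a holomorphic local
    parametrization, so at a critical point of [pi] neither the dimension nor the isotropy of
    [ker d pi] is at hand. Isotropy of the kernel would not pass to limits either, since the kernel
    may jump. The opposite inclusion does: that the orthogonal of [ker d pi] lies in [ker d pi] is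
    the matrix identity [A^T W^-1 A = 0], with [A] the matrix of [d pi] and [W] that of [Re Omega],
    and its left side is continuous in the point whatever the rank of [A].

    Along the section no limit is taken: [d S] is a right inverse of [d pi] at [S b], so these
    points are regular. Hence the base has dimension n and the kernel is isotropic there, which
    serves both the absence of a (0,2)-part and the holomorphy of [S].

    The covector that defines [h] is complex linear because [eta] has no (0,2)-part; this is why
    solving a real linear system for [h] is enough. *)

(** * Frechet differentials through epsilon estimates *)

Section Differentiability.
Variables (R : realType) (V W : normedModType R).

Definition lin_fun (U U' : lmodType R) (L : U -> U') : Prop :=
  forall (a : R) u v, L (a *: u + v) = a *: L u + L v.

(** Linearity is carried as a predicate, because many linear maps below are given by formulas; the
    bundled morphism is recovered only to characterise the differential. *)
Lemma lin_funP (L : V -> W) : lin_fun L ->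
  exists L' : {linear V -> W}, L' = L :> (V -> W).
Proof.
move=> linL.
pose hL := GRing.isLinear.Build R V W *:%R L linL.
by exists (HB.pack L hL : {linear V -> W}).
Qed.

Lemma lin_linear (L : {linear V -> W}) : lin_fun L.
Proof. by move=> a u v; rewrite linearP. Qed.

Lemma diff_lin_fun (f : V -> W) x : lin_fun ('d f x).
Proof. exact: lin_linear. Qed.

(** The linear term of a first order expansion is unique, so one estimate yields both
    differentiability and the value of the differential. *)
Lemma eps_diff (f L : V -> W) (x : V) : lin_fun L -> continuous L ->
  (forall e : R, 0 < e ->
     \forall h \near (0 : V), `|f (h + x) - f x - L h| <= e * `|h|) ->
  differentiable f x /\ 'd f x = L :> (V -> W).
Proof.
move=> /lin_funP[L' LL'] Lc fL; rewrite -{}LL' in Lc fL *.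
have fE : f \o shift x = cst (f x) + L' +o_ (0 : V) id.
  apply/eqaddoP => e e0; have := fL e e0; apply: filterS => h.
  by rewrite -[(_ - _) h]/(f (h + x) - (f x + L' h)) opprD addrA.
have dL : 'd f x = L' :> (V -> W) by exact: diff_unique.
by split=> //; apply/diff_locallyP; rewrite dL.
Qed.

Lemma diff_eps (f : V -> W) (x : V) : differentiable f x ->
  forall e : R, 0 < e ->
    \forall h \near (0 : V), `|f (h + x) - f x - 'd f x h| <= e * `|h|.
Proof.
move=> /diff_locallyP[_ /eqaddoP fE] e e0; have := fE e e0; apply: filterS => h.
by rewrite -[(_ - _) h]/(f (h + x) - (f x + 'd f x h)) opprD addrA.
Qed.

(** Charts are total functions constrained only on their domains, so identities between coordinate
    expressions hold merely near a point; differentials are transported along such local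
    identities. *)
Lemma near_eq_diff (f g : V -> W) (x : V) : (\near x, f x = g x) ->
  differentiable f x -> differentiable g x /\ 'd g x = 'd f x :> (V -> W).
Proof.
move=> fg df; apply: eps_diff.
- exact: diff_lin_fun.
- exact: diff_continuous.
- move=> e e0; have := diff_eps df e0.
  have fg0 : \forall h \near (0 : V), f (h + x) = g (h + x).
    by move: fg; rewrite (near_shift 0)/= subr0.
  move=> H; near=> h; rewrite -(nbhs_singleton fg) -(near fg0 h)//.
  by near: h.
Unshelve. all: by end_near. Qed.

End Differentiability.

(** * Coordinates on C^n *)

Section Coordinates.
Variables (R : realType) (n : nat).

(** A single row of length 2n turns real linear maps into matrices; [co] and [be] are the
    coordinates and the standard basis in this form. *)
Definition flat (v : Cn R n) : 'rV[R]_(n + n) := row_mx v.1 v.2.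
Definition unflat (v : 'rV[R]_(n + n)) : Cn R n := (lsubmx v, rsubmx v).
Definition co (i : 'I_(n + n)) (v : Cn R n) : R := flat v 0 i.
Definition be (i : 'I_(n + n)) : Cn R n := unflat (delta_mx 0 i).

Lemma flatK : cancel flat unflat.
Proof. by case=> a b; rewrite /unflat /flat row_mxKl row_mxKr. Qed.

Lemma unflatK : cancel unflat flat.
Proof. by move=> v; rewrite /flat /unflat hsubmxK. Qed.

Lemma flat_lin : lin_fun flat.
Proof.
by move=> a u v; rewrite /flat /= scale_row_mx add_row_mx.
Qed.

Lemma unflat_lin : lin_fun unflat.
Proof. by move=> a u v; rewrite /unflat !linearP. Qed.

Lemma co_lin i : lin_fun (co i : Cn R n -> R).
Proof. by move=> a u v; rewrite /co flat_lin !mxE. Qed.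

Lemma coP u v : (forall i, co i u = co i v) -> u = v.
Proof.
by move=> uv; rewrite -(flatK u) -(flatK v); congr unflat; apply/rowP => i; exact: uv.
Qed.

Lemma co_be i j : co i (be j) = (i == j)%:R.
Proof. by rewrite /co unflatK mxE eqxx. Qed.

(** The norms of rows and of pairs are both maxima, so coordinates and norm are compared without a
    constant, here and in the converse [le_cor]. *)
Lemma cor_le i (v : Cn R n) : `|co i v| <= `|v|.
Proof.
have rV_le k (x : 'rV[R]_k) j : `|x 0 j| <= `|x|.
  rewrite [leRHS]/Num.norm/= mx_normrE.
  exact: (le_bigmax _ (fun ij : (_ * _)%type => Num.norm (x ij.1 ij.2)) (0, j)).
rewrite /co /flat mxE; case: splitP => j _.
  apply: le_trans (rV_le _ _ _) _; by rewrite prod_normE le_max lexx.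
by apply: le_trans (rV_le _ _ _) _; rewrite prod_normE le_max lexx orbT.
Qed.

Lemma le_cor (v : Cn R n) (e : R) : 0 <= e -> (forall i, `|co i v| <= e) -> `|v| <= e.
Proof.
move=> e0 H; rewrite prod_normE ge_max; apply/andP; split;
  rewrite [leLHS]/Num.norm/= mx_normrE; apply/bigmax_leP; split=> // -[i j] _ /=.
  have := H (lshift _ j); rewrite /co /flat row_mxEl.
  by rewrite (ord1 i).
have := H (rshift _ j); rewrite /co /flat row_mxEr.
by rewrite (ord1 i).
Qed.

End Coordinates.

(** * Linear maps out of C^n: expansion in the basis, continuity, differentials *)

Section LinFun.
Variables (R : realType).
Lemma lin_funD (V W : lmodType R) (L : V -> W) : lin_fun L ->
  forall u v, L (u + v) = L u + L v.
Proof. by move=> h u v; rewrite -[u]scale1r h !scale1r. Qed.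

Lemma lin_fun0 (V W : lmodType R) (L : V -> W) : lin_fun L -> L 0 = 0.
Proof.
by move=> h; apply: (addrI (L 0)); rewrite -lin_funD// !addr0.
Qed.

Lemma lin_funZ (V W : lmodType R) (L : V -> W) : lin_fun L ->
  forall a v, L (a *: v) = a *: L v.
Proof. by move=> h a v; rewrite -[a *: v]addr0 h lin_fun0// addr0. Qed.

Lemma lin_funN (V W : lmodType R) (L : V -> W) : lin_fun L ->
  forall v, L (- v) = - L v.
Proof. by move=> h v; rewrite -scaleN1r lin_funZ// scaleN1r. Qed.

Lemma lin_funB (V W : lmodType R) (L : V -> W) : lin_fun L ->
  forall u v, L (u - v) = L u - L v.
Proof. by move=> h u v; rewrite lin_funD// lin_funN. Qed.

Lemma lin_fun_sum (V W : lmodType R) (L : V -> W) I (r : seq I) (F : I -> V) :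
  lin_fun L -> L (\sum_(i <- r) F i) = \sum_(i <- r) L (F i).
Proof.
move=> h; elim/big_rec2: _ => [|i x y _ <-]; first exact: lin_fun0.
exact: lin_funD.
Qed.

Lemma mulI_lin n : lin_fun (@mulI R n).
Proof.
move=> a [u1 u2] [v1 v2]; rewrite /mulI /= -[RHS]/(a *: (- u2) + - v2, a *: u1 + v1).
by rewrite opprD scalerN.
Qed.

Lemma mulIK n (u : Cn R n) : mulI (mulI u) = - u.
Proof. by case: u => a b; rewrite /mulI /=. Qed.

Lemma be_sum n (v : Cn R n) : v = \sum_i co i v *: be R i.
Proof.
apply: coP => j; rewrite (lin_fun_sum _ _ (co_lin j)) (bigD1 j)//=.
rewrite (lin_funZ (co_lin j)) co_be eqxx big1 ?addr0 => [|i ij].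
  by rewrite -[_ *: _]/(_ * _) mulr1.
by rewrite (lin_funZ (co_lin j)) co_be eq_sym (negbTE ij) -[_ *: _]/(_ * _) mulr0.
Qed.

Lemma lin_fun_be n (W : lmodType R) (L : Cn R n -> W) v : lin_fun L ->
  L v = \sum_i co i v *: L (be R i).
Proof.
move=> hL; rewrite {1}(be_sum v) (lin_fun_sum _ _ hL).
by apply: eq_bigr => i _; rewrite lin_funZ.
Qed.

Lemma co_continuous n i : continuous (@co R n i).
Proof.
move=> x; apply/cvgrPdist_le => e e0; near=> y.
rewrite -(lin_funB (co_lin i)); apply: le_trans (cor_le _ _) _.
by near: y; apply: cvgr_dist_le => //; exact: cvg_id.
Unshelve. all: by end_near. Qed.

Lemma lin_continuous n (W : normedModType R) (L : Cn R n -> W) :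
  lin_fun L -> continuous L.
Proof.
move=> hL; rewrite (_ : L = fun v => \sum_i co i v *: L (be R i)); last first.
  by apply/funext => v; exact: lin_fun_be.
move=> x; apply: cvg_big => [|i _]; first exact: add_continuous.
apply: cvgZr_tmp; exact: co_continuous.
Qed.

Lemma continuous_coP (T : topologicalType) n (f : T -> Cn R n) (x : T) :
  (forall i, {for x, continuous (co i \o f)}) -> {for x, continuous f}.
Proof.
move=> H; apply/cvgrPdist_le => e e0.
have : \forall y \near x, forall i, `|co i (f x) - co i (f y)| <= e.
  apply: filter_forall => i.
  by move: e e0; apply/cvgrPdist_le; exact: H.
apply: filterS => y Hy; apply: le_cor => [|i]; first exact: ltW.
by rewrite (lin_funB (co_lin i)).
Qed.

Lemma diff_lin_id n (W : normedModType R) (L : Cn R n -> W) x :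
  lin_fun L -> differentiable L x /\ 'd L x = L :> (Cn R n -> W).
Proof.
move=> hL; apply: eps_diff => //; first exact: lin_continuous.
move=> e e0; near=> h.
rewrite (lin_funD hL). by rewrite addrK subrr normr0 mulr_ge0// ltW.
Unshelve. all: by end_near. Qed.

Lemma differentiable_coP (V : normedModType R) n (f : V -> Cn R n) (x : V) :
  (forall i, differentiable (co i \o f) x) -> differentiable f x.
Proof.
move=> H.
rewrite (_ : f = \sum_(i < n + n) (fun y => co i (f y) *: be R i)); last first.
  by apply/funext => y; rewrite fct_sumE; exact: be_sum.
apply: differentiable_sum => i; apply: differentiableZl; exact: H.
Qed.

Lemma differentiable_co (V : normedModType R) n (f : V -> Cn R n) (x : V) i :
  differentiable f x -> differentiable (co i \o f) x.
Proof.
move=> H; apply: differentiable_comp => //.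
by have [] := diff_lin_id (f x) (@co_lin R n i).
Qed.

Lemma diff_lin_comp (V : normedModType R) n (W : normedModType R)
    (f : V -> Cn R n) (L : Cn R n -> W) (x : V) :
  lin_fun L -> differentiable f x ->
  differentiable (L \o f) x /\ 'd (L \o f) x = L \o 'd f x :> (V -> W).
Proof.
move=> hL df; have [dL LE] := diff_lin_id (f x) hL.
split; first exact: differentiable_comp.
by rewrite diff_comp// LE.
Qed.

Lemma derive_lin_comp (V : normedModType R) n (W : normedModType R)
    (f : V -> Cn R n) (L : Cn R n -> W) (x v : V) :
  lin_fun L -> differentiable f x -> 'D_v (L \o f) x = L ('D_v f x).
Proof.
move=> hL df; have [dLf LE] := diff_lin_comp hL df.
by rewrite deriveE// LE deriveE.
Qed.

End LinFun.

(** * Smooth maps *)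

Section Ck.
Variables (R : realType) (V : normedModType R).
Implicit Types (U : set V) (W : normedModType R).

Lemma open_near U (P : V -> Prop) x : open U -> U x -> (forall y, U y -> P y) ->
  \forall y \near x, P y.
Proof.
by move=> oU Ux H; apply: filterS H _; apply: open_nbhs_nbhs.
Qed.

Lemma continuous_dist_le W (f : V -> W) x (e : R) : {for x, continuous f} -> 0 < e ->
  \forall y \near x, `|f x - f y| <= e.
Proof. by move=> /cvgrPdist_le; exact. Qed.

Lemma Ck_on_sub W k U U' (f : V -> W) : U' `<=` U -> Ck_on k U f -> Ck_on k U' f.
Proof.
elim: k f => [|k IH] f sUU' /=; first by move=> H x /sUU'; exact: H.
by case=> H1 H2; split=> [x /sUU'|v]; [exact: H1|exact: IH].
Qed.

Lemma Ck_on_eq W k U (f g : V -> W) : open U -> (forall x, U x -> f x = g x) ->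
  Ck_on k U f -> Ck_on k U g.
Proof.
move=> oU; elim: k f g => [|k IH] f g fg /=.
  move=> H x Ux; have := H x Ux.
  rewrite /prop_for/= /continuous_at -fg// => fx.
  apply: cvg_trans fx; apply: near_eq_cvg; apply: open_near oU Ux _ => y Uy.
  by rewrite fg.
move=> [H1 H2]; split=> [x Ux|v].
  by have [] := near_eq_diff (open_near oU Ux fg) (H1 x Ux).
apply: IH (H2 v) => x Ux; apply: near_eq_derive; exact: open_near oU Ux fg.
Qed.

(** Continuity and differentiability are required at each point in the ambient space, not relative
    to [U]; the condition is therefore pointwise and the sets need not be open. *)
Lemma Ck_on_local W k U (f : V -> W) :
  (forall x, U x -> exists U', U' x /\ Ck_on k U' f) -> Ck_on k U f.
Proof.
elim: k f => [|k IH] f H /=; first by move=> x /H[U' [U'x]]; exact.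
split=> [x /H[U' [U'x []]]|v]; first by move=> + _; exact.
by apply: IH => x /H[U' [U'x [_]]] /(_ v); exists U'.
Qed.

Lemma Ck_onS W k U (f : V -> W) : Ck_on k.+1 U f -> Ck_on k U f.
Proof.
elim: k f => [|k IH] f; last first.
  by case=> H1 H2; split => // v; apply: IH; exact: H2.
by case=> H1 _ x Ux; apply: differentiable_continuous; exact: H1.
Qed.

Lemma smooth_on_derive W U (f : V -> W) v :
  smooth_on U f -> smooth_on U (fun x => 'D_v f x).
Proof. by move=> H k; have [_] := H k.+1; exact. Qed.

Lemma smooth_on_diff W U (f : V -> W) x :
  smooth_on U f -> U x -> differentiable f x.
Proof. by move=> /(_ 1%N)[H _]; exact: H. Qed.

Lemma Ck_on_derive W k U (f : V -> W) v : Ck_on k.+1 U f ->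
  Ck_on k U (fun x => 'D_v f x).
Proof. by case=> _; exact. Qed.

Lemma Ck_on_dist_le W k U (f : V -> W) x (e : R) : Ck_on k U f -> U x -> 0 < e ->
  \forall y \near x, `|f x - f y| <= e.
Proof.
elim: k f => [|k IH] f H Ux e0; last exact: IH (Ck_onS H) Ux e0.
exact: continuous_dist_le (H x Ux) e0.
Qed.

Lemma Ck_on_cst W k U (a : W) : Ck_on k U (fun _ => a).
Proof.
elim: k a => [|k IH] a /=; first by move=> x _; exact: cst_continuous.
split=> [x _|v]; first exact: differentiable_cst.
rewrite (_ : (fun x => 'D_v (fun=> a) x) = fun=> 0); first exact: IH.
by apply/funext => x; rewrite derive_cst.
Qed.

Lemma Ck_onD W k U (f g : V -> W) : open U ->
  Ck_on k U f -> Ck_on k U g -> Ck_on k U (fun x => f x + g x).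
Proof.
move=> oU; elim: k f g => [|k IH] f g /=.
  by move=> Hf Hg x Ux; apply: cvgD; [exact: Hf|exact: Hg].
move=> [f1 f2] [g1 g2]; split=> [x Ux|v].
  by apply: differentiableD; [exact: f1|exact: g1].
apply: Ck_on_eq (IH _ _ (f2 v) (g2 v)) => // x Ux.
by rewrite deriveD//; apply: diff_derivable; [exact: f1|exact: g1].
Qed.

Lemma Ck_onZ W k U (a : R) (f : V -> W) : open U ->
  Ck_on k U f -> Ck_on k U (fun x => a *: f x).
Proof.
move=> oU; elim: k f => [|k IH] f /=.
  by move=> Hf x Ux; apply: cvgZl_tmp; exact: Hf.
move=> [f1 f2]; split=> [x Ux|v].
  by apply: differentiableZ; exact: f1.
apply: Ck_on_eq (IH _ (f2 v)) => // x Ux.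
by rewrite deriveZ//; apply: diff_derivable; exact: f1.
Qed.

Lemma Ck_onN W k U (f : V -> W) : open U ->
  Ck_on k U f -> Ck_on k U (fun x => - f x).
Proof.
move=> oU /(Ck_onZ (-1) oU); apply: Ck_on_eq => // x _.
by rewrite scaleN1r.
Qed.

Lemma Ck_onB W k U (f g : V -> W) : open U ->
  Ck_on k U f -> Ck_on k U g -> Ck_on k U (fun x => f x - g x).
Proof. by move=> oU Hf Hg; apply: Ck_onD => //; exact: Ck_onN. Qed.

Lemma Ck_on_sum W k U I (r : seq I) (P : pred I) (F : I -> V -> W) : open U ->
  (forall i, P i -> Ck_on k U (F i)) ->
  Ck_on k U (fun x => \sum_(i <- r | P i) F i x).
Proof.
move=> oU H; elim: r => [|i r IH].
  apply: Ck_on_eq (@Ck_on_cst W k U 0) => // x _; by rewrite big_nil.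
have [Pi|nPi] := boolP (P i).
  apply: Ck_on_eq (Ck_onD oU (H i Pi) IH) => // x _.
  by rewrite big_cons Pi.
by apply: Ck_on_eq IH => // x _; rewrite big_cons (negbTE nPi).
Qed.

Lemma Ck_onM k U (f g : V -> R) : open U ->
  Ck_on k U f -> Ck_on k U g -> Ck_on k U (fun x => f x * g x).
Proof.
move=> oU; elim: k f g => [|k IH] f g.
  by move=> Hf Hg x Ux; apply: cvgM; [exact: Hf|exact: Hg].
move=> Hf Hg; have [f1 f2] := Hf; have [g1 g2] := Hg; split=> [x Ux|v].
  by apply: differentiableM; [exact: f1|exact: g1].
have H1 := IH _ _ (Ck_onS Hf) (g2 v).
have H2 := IH _ _ (Ck_onS Hg) (f2 v).
apply: Ck_on_eq (Ck_onD oU H1 H2) => // x Ux.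
by rewrite deriveM//; apply: diff_derivable; [exact: f1|exact: g1].
Qed.

Lemma Ck_on_prod k U I (r : seq I) (P : pred I) (F : I -> V -> R) : open U ->
  (forall i, P i -> Ck_on k U (F i)) ->
  Ck_on k U (fun x => \prod_(i <- r | P i) F i x).
Proof.
move=> oU H; elim: r => [|i r IH].
  apply: Ck_on_eq (Ck_on_cst k U (1 : R)) => // x _; by rewrite big_nil.
have [Pi|nPi] := boolP (P i).
  apply: Ck_on_eq (Ck_onM oU (H i Pi) IH) => // x _.
  by rewrite big_cons Pi.
by apply: Ck_on_eq IH => // x _; rewrite big_cons (negbTE nPi).
Qed.

Lemma Ck_onV k U (f : V -> R) : open U -> (forall x, U x -> f x != 0) ->
  Ck_on k U f -> Ck_on k U (fun x => (f x)^-1).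
Proof.
move=> oU f0; elim: k => [|k IH] Hf.
  by move=> x Ux; apply: cvgV; [exact: f0|exact: Hf].
have [f1 f2] := Hf; split=> [x Ux|v].
  by apply: differentiableV; [exact: f1|exact: f0].
have H := IH (Ck_onS Hf).
apply: Ck_on_eq (Ck_onN oU (Ck_onM oU (Ck_onM oU H H) (f2 v))) => // x Ux.
rewrite deriveV//; last by apply: diff_derivable; exact: f1.
- by rewrite -[_ *: _]/(_ * _) mulNr expr2 invfM.
- exact: f0.
Qed.

Lemma Ck_on_coP n k U (f : V -> Cn R n) : open U ->
  (forall i, Ck_on k U (co i \o f)) -> Ck_on k U f.
Proof.
move=> oU; elim: k f => [|k IH] f H /=.
  by move=> x Ux; apply: continuous_coP => i; exact: H.
have df x : U x -> differentiable f x.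
  by move=> Ux; apply: differentiable_coP => i; have [] := H i; move=> + _; exact.
split=> // v; apply: IH => i; have [_ /(_ v)] := H i.
apply: Ck_on_eq => // x Ux; apply: derive_lin_comp; [exact: co_lin|exact: df].
Qed.

Lemma Ck_on_lin n W k U (L : Cn R n -> W) (f : V -> Cn R n) : open U ->
  lin_fun L -> Ck_on k U f -> Ck_on k U (L \o f).
Proof.
move=> oU hL; elim: k f => [|k IH] f /=.
  move=> H x Ux; apply: continuous_comp; [exact: H|exact: lin_continuous].
move=> [f1 f2]; split=> [x Ux|v].
  by have [] := diff_lin_comp hL (f1 x Ux).
apply: Ck_on_eq (IH _ (f2 v)) => // x Ux /=.
by rewrite derive_lin_comp//; exact: f1.
Qed.

End Ck.

Lemma Ck_on_linear (R : realType) n (W : normedModType R) k (U : set (Cn R n))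
  (L : Cn R n -> W) : lin_fun L -> Ck_on k U L.
Proof.
move=> hL; case: k => [|k]; first by move=> x _; exact: lin_continuous.
split=> [x _|v]; first by have [] := diff_lin_id x hL.
rewrite (_ : (fun x => 'D_v L x) = fun=> L v); first exact: Ck_on_cst.
apply/funext => x; have [dL E] := diff_lin_id x hL.
exact: etrans (deriveE v dL) (congr1 (@^~ v) E).
Qed.

Section CkComp.
Variables (R : realType) (V : normedModType R).

Lemma diff_be n (W : normedModType R) (f : Cn R n -> W) p v :
  differentiable f p -> 'd f p v = \sum_i co i v *: 'D_(be R i) f p.
Proof.
move=> df; rewrite (lin_fun_be _ (diff_lin_fun f p)).
by apply: eq_bigr => i _; rewrite deriveE.
Qed.

Lemma derive_comp n (W : normedModType R) (f : V -> Cn R n) (g : Cn R n -> W) x v :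
  differentiable f x -> differentiable g (f x) ->
  'D_v (g \o f) x = \sum_i co i ('D_v f x) *: 'D_(be R i) g (f x).
Proof.
move=> df dg; rewrite deriveE; last exact: differentiable_comp.
by rewrite diff_comp//= diff_be// deriveE.
Qed.

Lemma Ck_on_comp_R n k (U : set V) (U' : set (Cn R n)) (f : V -> Cn R n) (g : Cn R n -> R) :
  open U -> (forall x, U x -> U' (f x)) ->
  Ck_on k U f -> Ck_on k U' g -> Ck_on k U (g \o f).
Proof.
move=> oU fU; elim: k f g fU => [|k IH] f g fU.
  by move=> Hf Hg x Ux; apply: continuous_comp; [exact: Hf|apply: Hg; exact: fU].
move=> Hf Hg; have [f1 f2] := Hf; have [g1 g2] := Hg; split=> [x Ux|v].
  by apply: differentiable_comp; [exact: f1|apply: g1; exact: fU].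
(* The chain rule in coordinates: [F] is the derivative of [g \o f] along [v]. Its factors are a
   derivative of [f] and a composite of [f] with a derivative of [g], to which the induction
   hypothesis applies. *)
pose F x := \sum_i co i ('D_v f x) * ('D_(be R i) g \o f) x.
have : Ck_on k U F.
  apply: Ck_on_sum => // i _; apply: Ck_onM => //.
    by apply: (Ck_on_lin oU (co_lin i)); exact: f2.
  by apply: IH (fU) (Ck_onS Hf) (g2 _).
apply: Ck_on_eq => // x Ux; rewrite derive_comp//; first exact: f1.
by apply: g1; exact: fU.
Qed.

Lemma Ck_on_comp n m k (U : set V) (U' : set (Cn R n)) (f : V -> Cn R n)
    (g : Cn R n -> Cn R m) :
  open U -> open U' -> (forall x, U x -> U' (f x)) ->
  Ck_on k U f -> Ck_on k U' g -> Ck_on k U (g \o f).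
Proof.
move=> oU oU' fU Hf Hg; apply: Ck_on_coP => // i.
apply: (Ck_on_comp_R (g := co i \o g) oU fU Hf).
by apply: Ck_on_lin => //; exact: co_lin.
Qed.

Lemma Ck_on_diff n (W : normedModType R) k (U : set (Cn R n)) (f : Cn R n -> W) v :
  open U -> Ck_on k.+1 U f -> Ck_on k U (fun x => 'd f x v).
Proof.
move=> oU [f1 f2]; apply: Ck_on_eq (f2 v) => // x Ux.
by rewrite deriveE//; exact: f1.
Qed.

Lemma smooth_on_comp n m (U : set V) (U' : set (Cn R n)) (f : V -> Cn R n)
    (g : Cn R n -> Cn R m) :
  open U -> open U' -> (forall x, U x -> U' (f x)) ->
  smooth_on U f -> smooth_on U' g -> smooth_on U (g \o f).
Proof. by move=> oU oU' fU Hf Hg k; exact: Ck_on_comp (Hf k) (Hg k). Qed.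

End CkComp.

(** * Mean value theorem and symmetry of second derivatives *)

Lemma diff_add (R : realType) (V W : normedModType R) (f g : V -> W) x v :
  differentiable f x -> differentiable g x ->
  'd (fun y => f y + g y) x v = 'd f x v + 'd g x v.
Proof. by move=> df dg; rewrite -[fun y => _]/(f + g) diffD. Qed.

Lemma diff_sub (R : realType) (V W : normedModType R) (f g : V -> W) x v :
  differentiable f x -> differentiable g x ->
  'd (fun y => f y - g y) x v = 'd f x v - 'd g x v.
Proof. by move=> df dg; rewrite -[fun y => _]/(f - g) diffB. Qed.

Section MeanValue.
Variables (R : realType) (V : normedModType R).

Lemma mean_value (f : V -> R) (a h : V) :
  (forall t : R, 0 <= t <= 1 -> differentiable f (a + t *: h)) ->
  exists2 c : R, 0 < c < 1 & f (a + h) - f a = 'd f (a + c *: h) h.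
Proof.
move=> df.
pose g (t : R) := f (a + t *: h).
have dl (t : R) : is_derive t 1 (fun t : R => a + t *: h) h.
  have := @is_deriveD _ _ _ (cst a) (fun t : R => t *: h) t 1 0 h.
  rewrite add0r; apply.
  have Hs : is_diff t (fun t : R => t *: h) (fun t => t *: h).
    exact: is_diff_scalel.
  apply: DeriveDef; first by apply/derivable1_diffP; case: Hs.
  by rewrite deriveE; [case: Hs => _ ->; rewrite scale1r|case: Hs].
have dg (t : R) : 0 <= t <= 1 -> is_derive t 1 g ('d f (a + t *: h) h).
  move=> t01; have [H1 H2] := dl t.
  have H1' : differentiable (fun t : R => a + t *: h) t by exact/derivable1_diffP.
  apply: DeriveDef.
    by apply/derivable1_diffP; apply: differentiable_comp => //; exact: df.
  rewrite deriveE; last by apply: differentiable_comp => //; exact: df.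
  rewrite diff_comp//=; last exact: df.
  by rewrite -(deriveE (1 : R) H1') H2.
have [] := @MVT R g (fun t => 'd f (a + t *: h) h) 0 1 ltr01.
- by move=> t; rewrite in_itv/= => /andP[t0 t1]; apply: dg; rewrite !ltW.
- apply: derivable_within_continuous => t; rewrite in_itv/= => /dg; by case.
move=> c; rewrite in_itv/= => c01; rewrite /g scale1r scale0r addr0 subr0 mulr1 => E.
by exists c.
Qed.

(** Each real coordinate has its own intermediate point; as the norm is a maximum over the
    coordinates, the bound survives with the same constant. *)
Lemma mean_value_le n (f : V -> Cn R n) (a h : V) (k : R) : 0 <= k ->
  (forall t : R, 0 <= t <= 1 ->
    differentiable f (a + t *: h) /\ `|'d f (a + t *: h) h| <= k) ->
  `|f (a + h) - f a| <= k.
Proof.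
move=> k0 H; apply: le_cor => // i.
have [|c c01 E] := @mean_value (co i \o f) a h.
  by move=> t /H[+ _]; exact: differentiable_co.
rewrite (lin_funB (co_lin i)) [X in `|X|]E.
have /H[df dk] : 0 <= c <= 1 by case/andP: c01 => *; rewrite !ltW.
have [_ ->] := diff_lin_comp (co_lin i) df.
by apply: le_trans dk; exact: cor_le.
Qed.

Lemma diff_shift (W : normedModType R) (f : V -> W) (x v : V) :
  differentiable f (x + v) ->
  differentiable (fun y => f (y + v)) x /\
  'd (fun y => f (y + v)) x = 'd f (x + v) :> (V -> W).
Proof.
move=> df.
have ds : is_diff x (fun y => y + v) id.
  rewrite (_ : id = id + 0 :> (V -> V)); last first.
    by apply/funext => y; rewrite -[RHS]/(y + 0) addr0.
  rewrite (_ : (fun y => y + v) = id + cst v)//.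
  by apply: is_diffD; exact: is_diff_id.
have [ds1 ds2] := ds; split; first exact: differentiable_comp.
by rewrite (_ : (fun y => f (y + v)) = f \o (fun y => y + v))// diff_comp// ds2.
Qed.

(** The second difference of [f] over the parallelogram with sides [t u] and [t v] equals t^2 times
    either mixed derivative, taken at some point of the parallelogram; continuity of both
    derivatives at [x] makes them agree up to any [e]. *)
Lemma Schwarz (U : set V) (f : V -> R) (x u v : V) : open U -> U x -> Ck_on 2 U f ->
  'D_u (fun y => 'D_v f y) x = 'D_v (fun y => 'D_u f y) x.
Proof.
move=> oU Ux d3f; have [df d2f] := d3f.
apply/eqP; rewrite -subr_eq0 -normr_le0; apply/ler_addgt0Pl => e e0.
rewrite addr0.
have near_xt : \forall y \near x, U y /\
    `|'D_u (fun y => 'D_v f y) x - 'D_u (fun y => 'D_v f y) y| <= e / 2 /\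
    `|'D_v (fun y => 'D_u f y) x - 'D_v (fun y => 'D_u f y) y| <= e / 2.
  have e20 : 0 < e / 2 by rewrite divr_gt0.
  have c1 := Ck_on_dist_le (Ck_on_derive u (Ck_on_derive v d3f)) Ux e20.
  have c2 := Ck_on_dist_le (Ck_on_derive v (Ck_on_derive u d3f)) Ux e20.
  exact: filterI (open_nbhs_nbhs (conj oU Ux)) (filterI c1 c2).
have [r /= r0 Hr] : exists2 r : R, 0 < r & forall y, `|y - x| < r -> U y /\
    `|'D_u (fun y => 'D_v f y) x - 'D_u (fun y => 'D_v f y) y| <= e / 2 /\
    `|'D_v (fun y => 'D_u f y) x - 'D_v (fun y => 'D_u f y) y| <= e / 2.
  move/nbhs_ballP : near_xt => [r r0 Hr]; exists r => // y yx.
  by apply: Hr; rewrite -ball_normE /= distrC.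
(* The summand 1 keeps [k] positive when [u] and [v] vanish; [t * k < r] keeps the parallelogram in
   the ball of radius [r]. *)
pose k := `|u| + `|v| + 1.
have k0 : 0 < k by rewrite /k ltr_wpDl// addr_ge0.
have [t t0 tk] : exists2 t, 0 < t & t * k < r.
  exists (r / (2 * k)); first by rewrite divr_gt0// mulr_gt0.
  by rewrite invfM mulrA mulfVK ?gt_eqF// ltr_pdivrMr// ltr_pMr// ltr1n.
have small (a b : R) : 0 <= a <= 1 -> 0 <= b <= 1 ->
    `|(x + a *: (t *: u) + b *: (t *: v)) - x| < r.
  move=> /andP[a0 a1] /andP[b0 b1].
  rewrite -[x + _ + _]addrA [x + _]addrC addrK.
  apply: le_lt_trans (ler_normD _ _) _.
  rewrite !normrZ (ger0_norm a0) (ger0_norm b0) (gtr0_norm t0).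
  have : a * (t * `|u|) + b * (t * `|v|) <= t * (`|u| + `|v|).
    by rewrite mulrDr; apply: lerD; apply: ler_piMl => //; apply: mulr_ge0 => //; exact: ltW.
  move=> /le_lt_trans; apply.
  apply: (@lt_trans _ _ (t * k)); last exact: tk.
  by rewrite ltr_pM2l// /k ltrDl.
have key (p q : V) : (forall (a b : R), 0 <= a <= 1 -> 0 <= b <= 1 ->
      U (x + a *: (t *: p) + b *: (t *: q))) ->
   exists a b : R, [/\ 0 <= a <= 1, 0 <= b <= 1 &
     f (x + t *: p + t *: q) - f (x + t *: p) - f (x + t *: q) + f x =
     t * (t * 'D_q (fun y => 'D_p f y) (x + a *: (t *: p) + b *: (t *: q)))].
  move=> HU.
  (* The mean value theorem is applied to this increment along [p], then to the derivative of [f]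
     along [p] in the direction [q]. *)
  pose g y := f (y + t *: q) - f y.
  have dfs : forall c : R, 0 <= c <= 1 ->
      differentiable (fun y => f (y + t *: q)) (x + c *: (t *: p)) /\
      'd (fun y => f (y + t *: q)) (x + c *: (t *: p)) =
        'd f (x + c *: (t *: p) + t *: q) :> (V -> R).
    move=> c c01.
    have dfc : differentiable f (x + c *: (t *: p) + t *: q).
      apply: df; have := HU c 1 c01; rewrite scale1r; apply.
      by rewrite ler01 lexx.
    exact: diff_shift.
  have dfa : forall c : R, 0 <= c <= 1 -> differentiable f (x + c *: (t *: p)).
    move=> c c01; apply: df; have := HU c 0 c01; rewrite scale0r addr0; apply.
    by rewrite ler01 lexx.
  have dg : forall c : R, 0 <= c <= 1 -> differentiable g (x + c *: (t *: p)).
    by move=> c c01; apply: differentiableB; [have [] := dfs c c01|exact: dfa].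
  have [a a01 Ea] := mean_value dg.
  have {}a01 : 0 <= a <= 1 by case/andP: a01 => *; rewrite !ltW.
  have dh : forall c : R, 0 <= c <= 1 ->
      differentiable (fun y => 'D_p f y) (x + a *: (t *: p) + c *: (t *: q)).
    by move=> c c01; have [H _] := d2f p; apply: H; exact: HU.
  have [b b01 Eb] := mean_value dh.
  have {}b01 : 0 <= b <= 1 by case/andP: b01 => *; rewrite !ltW.
  exists a, b; split=> //.
  have -> : f (x + t *: p + t *: q) - f (x + t *: p) - f (x + t *: q) + f x =
      g (x + t *: p) - g x.
    by rewrite /g opprB addrA addrAC.
  have [dfs1 dfs2] := dfs a a01.
  rewrite Ea /g (diff_sub _ dfs1 (dfa a a01)) dfs2.
  rewrite (lin_funZ (diff_lin_fun f _)) (lin_funZ (diff_lin_fun f _)) -scalerBr.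
  have dfa1 : differentiable f (x + a *: (t *: p) + t *: q).
    by apply: df; have := HU a 1 a01; rewrite scale1r; apply; rewrite ler01 lexx.
  rewrite -(deriveE p dfa1) -(deriveE p (dfa a a01)) Eb (lin_funZ (diff_lin_fun _ _)).
  by rewrite -(deriveE q (dh b b01)).
have [|a [b [a01 b01 E1]]] := key u v.
  by move=> a b a01 b01; have [] := Hr _ (small a b a01 b01).
have [|b' [a' [b01' a01' E2]]] := key v u.
  by move=> b' a' b01' a01'; rewrite addrAC; have [] := Hr _ (small a' b' a01' b01').
have E12 : f (x + t *: v + t *: u) - f (x + t *: v) - f (x + t *: u) + f x =
    f (x + t *: u + t *: v) - f (x + t *: u) - f (x + t *: v) + f x.
  have -> : x + t *: v + t *: u = x + t *: u + t *: v by exact: addrAC.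
  congr (_ + _); exact: addrAC.
have := etrans (esym E2) (etrans E12 E1).
move/(mulfI (lt0r_neq0 t0))/(mulfI (lt0r_neq0 t0)) => E.
have [_ [_ B1]] := Hr _ (small a b a01 b01).
have [_ [B2 _]] := Hr _ (small a' b' a01' b01').
rewrite -(subrKA ('D_u (fun y => 'D_v f y) (x + b' *: (t *: v) + a' *: (t *: u)))).
apply: le_trans (ler_normD _ _) _; rewrite [leRHS](splitr e).
apply: lerD; first by rewrite addrAC.
rewrite E.
rewrite distrC.
exact: B1.
Qed.

End MeanValue.

(** * Inverse function theorem *)

Section SmoothMatrix.
Variables (R : realType) (V : normedModType R) (U : set V).
Hypothesis oU : open U.

Lemma Ck_on_det k d (A : V -> 'M[R]_d) :
  (forall i j, Ck_on k U (fun x => A x i j)) -> Ck_on k U (fun x => \det (A x)).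
Proof.
move=> H; apply: Ck_on_sum => // s _; apply: Ck_onM => //; first exact: Ck_on_cst.
by apply: Ck_on_prod => // i _; exact: H.
Qed.

(** Cramer's rule: the entries of the inverse are polynomials in those of the matrix, divided by the
    determinant. *)
Lemma Ck_on_invmx k d (A : V -> 'M[R]_d) :
  (forall x, U x -> A x \in unitmx) ->
  (forall i j, Ck_on k U (fun x => A x i j)) ->
  forall i j, Ck_on k U (fun x => invmx (A x) i j).
Proof.
move=> uA H i j.
have Hadj : Ck_on k U (fun x => (\det (A x))^-1 * \adj (A x) i j).
  apply: Ck_onM => //.
    apply: Ck_onV => //; last exact: Ck_on_det.
    by move=> x /uA; rewrite unitmxE unitfE.
  apply: (@Ck_on_eq _ _ _ _ _ (fun x => (-1) ^+ (j + i) *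
      \det (row' j (col' i (A x))))) => //.
    by move=> x _; rewrite mxE.
  apply: Ck_onM => //; first exact: Ck_on_cst.
  apply: Ck_on_det => i' j'; apply: Ck_on_eq (H (lift j i') (lift i j')) => // x _.
  by rewrite !mxE.
apply: Ck_on_eq Hadj => // x /uA uAx; by rewrite /invmx uAx [RHS]mxE.
Qed.

End SmoothMatrix.

(** * Matrices of real linear maps, acting on rows from the right *)

Section LinMatrix.
Variables (R : realType) (n m : nat).

Definition lmx (L : Cn R n -> Cn R m) : 'M[R]_(n + n, m + m) :=
  \matrix_(i, j) co j (L (be R i)).

Lemma flat_lmx L v : lin_fun L -> flat (L v) = flat v *m lmx L.
Proof.
move=> hL; apply/rowP => j; rewrite -[LHS]/(co j _) (lin_fun_be v hL).
rewrite (lin_fun_sum _ _ (co_lin j)) mxE; apply: eq_bigr => i _.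
by rewrite (lin_funZ (co_lin j)) [lmx _ _ _]mxE.
Qed.

Lemma mx_lin (A : 'M[R]_(n + n, m + m)) : lin_fun (fun v : Cn R n => unflat (flat v *m A)).
Proof. by move=> a u v; rewrite flat_lin mulmxDl -scalemxAl unflat_lin. Qed.

End LinMatrix.

Lemma lmx_unit (R : realType) n (L : Cn R n -> Cn R n) : lin_fun L ->
  (forall v, L v = 0 -> v = 0) -> lmx L \in unitmx.
Proof.
move=> hL inj; rewrite -row_free_unit -kermx_eq0; apply/eqP/row_matrixP => i.
rewrite row0; set r := row i (kermx (lmx L)).
have r0 : r *m lmx L = 0 by rewrite /r -row_mul mulmx_ker row0.
have ur0 : unflat r = 0.
  apply: inj; rewrite -[LHS]flatK flat_lmx// unflatK r0.
  exact: (lin_fun0 (@unflat_lin R n)).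
by rewrite -[LHS]unflatK ur0; exact: (lin_fun0 (@flat_lin R n)).
Qed.

Lemma continuous_dist (R : realType) (V : normedModType R) (T : topologicalType)
    (f : T -> V) x (c : V) :
  {for x, continuous f} -> {for x, continuous (fun y => `|f y - c|)}.
Proof. by move=> cf; exact: (cvg_norm (cvgB cf (cvg_cst c))). Qed.

Section InverseFunction.
Variables (R : realType) (n : nat) (f : Cn R n -> Cn R n) (U : set (Cn R n)).
Variable p0 : Cn R n.
Hypotheses (oU : open U) (Up0 : U p0) (sf : smooth_on U f).
Hypothesis df0 : 'd f p0 = id :> (_ -> _).

Lemma near_expanding : exists2 r : R, 0 < r & forall x, `|x - p0| <= r ->
  U x /\ (forall h, `|'d f x h - h| <= 2^-1 * `|h|).
Proof.
(* The factor absorbs the sum over the 2n basis directions; the successor keeps it nonzero when n is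
   0. *)
pose e : R := (2 * (n + n).+1%:R)^-1.
have e0 : 0 < e by rewrite invr_gt0 mulr_gt0// ltr0n.
have : \forall x \near p0, U x /\ forall i, `|be R i - 'D_(be R i) f x| <= e.
  have Hi i : \forall x \near p0, `|be R i - 'D_(be R i) f x| <= e.
    have := Ck_on_dist_le (Ck_on_derive (be R i) (sf 1%N)) Up0 e0.
    by rewrite deriveE ?df0//; exact: smooth_on_diff sf Up0.
  have H := filter_forall (nbhs_filter _) Hi.
  have HU := open_nbhs_nbhs (conj oU Up0).
  exact: filterI HU H.
move/nbhs_ballP => [r /= r0 Hr]; exists (r / 2); first by rewrite divr_gt0.
move=> x xp.
have [Ux H] : U x /\ forall i, `|be R i - 'D_(be R i) f x| <= e.
  apply: Hr; rewrite -ball_normE/= distrC; apply: le_lt_trans xp _.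
  by rewrite ltr_pdivrMr// ltr_pMr// ltr1n.
split=> // h.
rewrite diff_be; last exact: smooth_on_diff sf Ux.
rewrite {2}(be_sum h) -sumrB; apply: le_trans (ler_norm_sum _ _ _) _.
apply: (@le_trans _ _ (\sum_(i < n + n) e * `|h|)).
  apply: ler_sum => i _; rewrite -scalerBr normrZ mulrC distrC.
  by apply: ler_pM => //; exact: cor_le.
rewrite sumr_const card_ord -[leLHS]mulr_natl mulrA; apply: ler_wpM2r => //.
rewrite /e invfM mulrCA ler_piMr// ?invr_ge0// ler_pdivrMr ?ltr0n// mul1r.
by rewrite ler_nat.
Qed.

(** Mean value bound for [f - id], which is 1/2-Lipschitz on a ball around [p0] because its
    differential is small there. *)
Lemma near_id_lipschitz : exists2 r : R, 0 < r &
  forall a b, `|a - p0| <= r -> `|b - p0| <= r ->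
  U a /\ `|(f b - f a) - (b - a)| <= 2^-1 * `|b - a| /\
  (forall h, `|'d f a h - h| <= 2^-1 * `|h|).
Proof.
have [r r0 Hr] := near_expanding; exists r => // a b ar br.
have [Ua Ha] := Hr a ar; split=> //; split=> //.
have E : f b - f a - (b - a) = (f (a + (b - a)) - (a + (b - a))) - (f a - a).
  by rewrite [a + _]addrC subrK !opprB [a - b]addrC addrACA [- f a + a]addrC.
rewrite E; apply: (@mean_value_le R _ n (fun x => f x - x) a (b - a)).
  by rewrite mulr_ge0.
move=> t /andP[t0 t1].
have /Hr[Ux Hx] : `|a + t *: (b - a) - p0| <= r.
  rewrite (_ : _ - p0 = (1 - t) *: (a - p0) + t *: (b - p0)); last first.
    rewrite scalerBl scale1r addrAC -[RHS]addrA; congr (_ + _).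
    by rewrite [RHS]addrC -scalerBr opprB addrA subrK.
  apply: le_trans (ler_normD _ _) _; rewrite !normrZ.
  rewrite (ger0_norm t0) ger0_norm ?subr_ge0//.
  have -> : r = (1 - t) * r + t * r by rewrite -mulrDl subrK mul1r.
  by apply: lerD; apply: ler_wpM2l; rewrite ?subr_ge0.
have dfx : differentiable f (a + t *: (b - a)) by exact: smooth_on_diff sf Ux.
have [idx did] := is_diff_id (a + t *: (b - a)).
split; first by apply: differentiableB => //.
have E1 := diff_sub (g := id) (b - a) dfx idx.
have E2 : 'd id (a + t *: (b - a)) (b - a) = b - a by exact: (congr1 (@^~ (b - a)) did).
have E3 := etrans E1 (congr1 (fun w => 'd f (a + t *: (b - a)) (b - a) - w) E2).
have H := Hx (b - a).
by rewrite -E3 in H.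
Qed.

(** Being a 1/2-Lipschitz perturbation of the identity, [f] shrinks distances at most by half:
    injectivity and a 2-Lipschitz inverse follow. The inverse lives on a whole ball, which later
    makes parameter domains star-shaped. *)
Theorem inverse_function : exists (O : set (Cn R n)) (g : Cn R n -> Cn R n) (d : R),
  [/\ 0 < d, open O, O p0, O `<=` U &
    [/\ forall p, O p -> forall v, 'd f p v = 0 -> v = 0,
        forall p, O p -> `|f p - f p0| < d /\ g (f p) = p,
        forall y, `|y - f p0| < d -> O (g y) /\ f (g y) = y &
        smooth_on [set y | `|y - f p0| < d] g]].
Proof.
have [r r0 Hr] := near_id_lipschitz.
(* With this radius the minimizer found below lies within [4 * d = r / 2] of [p0], and a step of
   length less than [d] from it stays in the ball of radius [r]. *)
pose d := r / 8.
have d0 : 0 < d by rewrite divr_gt0.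
pose O := [set p | `|p - p0| < r /\ `|f p - f p0| < d].
have p0r : `|p0 - p0| <= r by rewrite subrr normr0 ltW.
have exp2 a b : `|a - p0| <= r -> `|b - p0| <= r -> `|b - a| <= 2 * `|f b - f a|.
  move=> ar br; have [_ [H _]] := Hr a b ar br.
  have := ler_distD (f b - f a) (b - a) 0; rewrite !subr0 distrC => H2.
  lra.
have OU : O `<=` U by move=> p [/ltW pr _]; have [] := Hr p p0 pr p0r.
have cf x : U x -> {for x, continuous f} by exact: (sf 0%N).
pose B := [set p : Cn R n | `|p - p0| <= r].
have cB : compact B.
  pose A (c : 'rV[R]_n) := [set v : 'rV[R]_n | `|v - c| <= r].
  have cA c : compact (A c).
    apply: bounded_closed_compact.
      exists (r + `|c|); split; first exact: num_real.
      move=> x rx v vA; apply: ltW; apply: le_lt_trans rx.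
      by rewrite -[v](subrK c); apply: le_trans (ler_normD _ _) _; rewrite lerD2r.
    rewrite (_ : A c = (fun v : 'rV[R]_n => `|v - c|) @^-1` [set x : R | x <= r])//.
    apply: preimage_closed; last exact: closed_le.
    move=> v _; exact: (continuous_dist (f := id)).
  have := compact_setX (cA p0.1) (cA p0.2).
  rewrite (_ : A p0.1 `*` A p0.2 = B)//; apply/seteqP; split=> -[u v]; rewrite /B/A/=.
    by move=> [? ?]; rewrite prod_normE ge_max; apply/andP.
  by rewrite prod_normE ge_max => /andP[? ?].
(* A minimizer of [`|f x - y|] on the ball is a solution: otherwise the step
   [x + (y - f x)] of the fixed point iteration would decrease the distance. *)
have surj y : `|y - f p0| < d -> exists2 x, `|x - p0| < r & f x = y.
  move=> yd.
  have [|||x1 Bx1 minx1] := @compact_EVT_min _ R (fun x => `|f x - y|) B.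
  - by exists p0.
  - exact: cB.
  - apply: continuous_in_subspaceT => x; rewrite inE => Bx.
    have [Ux _] := Hr x p0 Bx p0r.
    apply: continuous_dist; exact: cf.
  move: Bx1; rewrite inE => Bx1.
  have e1 : `|f x1 - y| < d.
    by apply: le_lt_trans yd; rewrite [leRHS]distrC; apply: minx1; rewrite inE.
  have e2 : `|f x1 - f p0| < 2 * d.
    have := ler_distD y (f x1) (f p0); lra.
  have e3 : `|x1 - p0| < r / 2.
    by have := exp2 p0 x1 p0r Bx1; rewrite /d in e2; lra.
  exists x1; first lra.
  pose x2 := x1 + (y - f x1).
  have e4 : `|x2 - p0| <= r.
    rewrite /x2 addrAC; apply: le_trans (ler_normD _ _) _.
    by rewrite distrC in e1; rewrite /d in e1; lra.
  have [_ [H _]] := Hr x1 x2 Bx1 e4.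
  have := minx1 x2; rewrite inE => /(_ e4).
  move: H; rewrite (_ : x2 - x1 = y - f x1); last by rewrite /x2 addrC addKr.
  rewrite (_ : _ - _ - _ = f x2 - y); last by rewrite opprB addrA subrK.
  rewrite [`|y - _|]distrC => H H'.
  apply/eqP; rewrite -subr_eq0 -normr_le0; have := normr_ge0 (f x1 - y); lra.
pose g y := xget p0 [set x | `|x - p0| < r /\ f x = y].
have gP y : `|y - f p0| < d -> `|g y - p0| < r /\ f (g y) = y.
  move=> /surj[x xr fxy].
  exact: (@xgetPex _ p0 [set x | `|x - p0| < r /\ f x = y]) (ex_intro _ x (conj xr fxy)).
have oO : open O.
  rewrite openE => p [pr fpd].
  have Up : U p by apply: OU.
  have c1 : {for p, continuous (fun x => `|x - p0|)}.
    by exact: (continuous_dist (f := id)).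
  have c2 : {for p, continuous (fun x => `|f x - f p0|)}.
    by apply: continuous_dist; exact: cf.
  have n1 : \forall x \near p, `|x - p0| < r by exact: (cvgr_lt _ c1).
  have n2 : \forall x \near p, `|f x - f p0| < d by exact: (cvgr_lt _ c2).
  exact: filterI n1 n2.
have gO y : `|y - f p0| < d -> O (g y) /\ f (g y) = y.
  by move=> yd; have [gr fg] := gP y yd; rewrite /O/= fg.
have gK p : O p -> `|f p - f p0| < d /\ g (f p) = p.
  move=> [pr fpd]; split=> //; have [gr fg] := gP _ fpd.
  apply/eqP; rewrite -subr_eq0 -normr_le0.
  by have := exp2 _ _ (ltW pr) (ltW gr); rewrite fg subrr normr0 mulr0.
have inj p : O p -> forall v, 'd f p v = 0 -> v = 0.
  move=> [/ltW pr _] v E; have [_ [_ /(_ v)]] := Hr p p0 pr p0r.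
  rewrite E sub0r normrN => H; apply/eqP; rewrite -normr_le0.
  have := normr_ge0 v; lra.
exists O, g, d; split=> //; first by split; [rewrite subrr normr0|rewrite subrr normr0].
split=> //.
set D := [set y | _].
have oD : open D.
  rewrite (_ : D = (fun y : Cn R n => `|y - f p0|) @^-1` [set x : R | x < d])//.
  apply: open_comp; last exact: open_lt.
  move=> v _; exact: (continuous_dist (f := id)).
pose A p := lmx ('d f p).
have uA p : O p -> A p \in unitmx.
  by move=> Op; apply: lmx_unit; [exact: diff_lin_fun|exact: inj].
pose K p v : Cn R n := unflat (flat v *m invmx (A p)).
have linK p : lin_fun (K p) by exact: mx_lin.
have Kd p v : O p -> K p ('d f p v) = v.
  move=> Op; rewrite /K flat_lmx; last exact: diff_lin_fun.
  by rewrite -/(A p) mulmxK ?flatK//; exact: uA.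
have glip y y' : D y -> D y' -> `|g y' - g y| <= 2 * `|y' - y|.
  move=> /gP[r1 E1] /gP[r2 E2]; rewrite -{2}E1 -{2}E2; apply: exp2; exact: ltW.
have cg y : D y -> {for y, continuous g}.
  move=> Dy; apply/cvgrPdist_le => e e0.
  have H : \forall y' \near y, `|y - y'| <= e / 2.
    by apply: (continuous_dist_le (f := id)); [exact: cvg_id|rewrite divr_gt0].
  have HD : \forall y' \near y, D y' by exact: open_nbhs_nbhs.
  apply: filterS (filterI H HD) => y' [H1 Dy'].
  by have := glip y' y Dy' Dy; lra.
have dg y : D y -> differentiable g y /\ 'd g y = K (g y) :> (_ -> _).
  move=> Dy; have [Og fg] := gO y Dy.
  apply: eps_diff => //; first exact: lin_continuous.
  move=> e e0.
  have Kle v : `|K (g y) v| <= 2 * `|v|.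
    have [/ltW gr _] := Og.
    have [_ [_ /(_ (K (g y) v))]] := Hr (g y) p0 gr p0r.
    have -> : 'd f (g y) (K (g y) v) = v.
      rewrite /K -[LHS]flatK flat_lmx; last exact: diff_lin_fun.
      by rewrite unflatK -/(A (g y)) mulmxKV ?flatK//; exact: uA.
    have := ler_distD v (K (g y) v) 0; rewrite !subr0 distrC; lra.
  (* One factor 2 is lost to the bound on [K], another to the Lipschitz constant of [g]. *)
  have e4 : 0 < e / 4 by rewrite divr_gt0.
  have dfg : differentiable f (g y) by apply: smooth_on_diff sf _; exact: OU.
  have H := diff_eps dfg e4.
  have HD : \forall h \near (0 : Cn R n), D (h + y).
    have : \forall y' \near y, D y' by exact: open_nbhs_nbhs.
    by rewrite (near_shift 0)/= subr0.
  have Hk : \forall h \near (0 : Cn R n),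
      `|f ((g (h + y) - g y) + g y) - f (g y) - 'd f (g y) (g (h + y) - g y)| <=
        e / 4 * `|g (h + y) - g y|.
    have ck : (fun h => g (h + y) - g y) h @[h --> (0 : Cn R n)] --> (0 : Cn R n).
      have c0 : {for (0 : Cn R n), continuous (fun h => g (h + y))}.
        apply: (@continuous_comp _ _ _ (fun h => h + y) g).
          exact: (cvgD cvg_id (cvg_cst y)).
        by rewrite add0r; exact: cg.
      rewrite -[X in _ --> X](subrr (g y)) -[X in g X - _]add0r.
      exact: (cvgB c0 (cvg_cst (g y))).
    exact: (ck _ H).
  apply: filterS (filterI HD Hk) => h [Dh].
  set k := g (h + y) - g y.
  have [_ fgh] := gO _ Dh.
  rewrite subrK fgh fg addrK => Hh.
  (* The remainder of [g] is, up to sign, the inverse differential applied to the remainder of [f]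
     along [k]. *)
  have -> : k - K (g y) h = - K (g y) (h - 'd f (g y) k).
    by rewrite (lin_funB (linK _)) Kd// opprB.
  rewrite normrN; apply: le_trans (Kle _) _.
  have := glip y (h + y) Dy Dh; rewrite -/k addrK => kh.
  have : e / 4 * `|k| <= e / 4 * (2 * `|h|) by rewrite ler_pM2l.
  lra.
(* Bootstrap: the differential of [g] inverts that of [f] along [g], so by Cramer's rule its entries
   are as regular as [g], and each round gains one derivative. *)
elim=> [|k IH]; first exact: cg.
split=> [y /dg[]//|v].
apply: (@Ck_on_eq _ _ _ _ _ (fun y => K (g y) v)) => //.
  by move=> y /dg[dgy E]; rewrite deriveE// E.
apply: Ck_on_coP => // i.
pose F y := \sum_j co j v * invmx (A (g y)) j i.
apply: (@Ck_on_eq _ _ _ _ _ F) => //.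
  by move=> y _; rewrite /F /= /K /co unflatK mxE.
apply: Ck_on_sum => // j _; apply: Ck_onM => //; first exact: Ck_on_cst.
apply: Ck_on_invmx => // [y /gO[Og _]|a b]; first exact: uA.
apply: (@Ck_on_eq _ _ _ _ _ ((fun p => co b ('D_(be R a) f p)) \o g)) => //.
  move=> y /gO[Og _] /=; rewrite mxE deriveE//.
  by apply: smooth_on_diff sf _; exact: OU.
apply: (@Ck_on_comp_R _ _ _ _ _ U) => //; first by move=> y /gO[Og _]; exact: OU.
apply: (Ck_on_lin oU (co_lin b)); exact: smooth_on_derive.
Qed.

End InverseFunction.

(** * Charts and differentials *)

Lemma nbhs_continuous (T U : topologicalType) (f : T -> U) x (A : set U) :
  {for x, continuous f} -> open A -> A (f x) -> \forall y \near x, A (f y).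
Proof. by move=> cf oA Afx; apply: cf; exact: open_nbhs_nbhs. Qed.

Section ChartTopology.
Variables (R : realType) (n : nat) (M : topologicalType) (c : chart R n M).

Lemma open_preim (T U : topologicalType) (f : T -> U) (A : set T) (B : set U) :
  open A -> open B -> (forall x, A x -> {for x, continuous f}) ->
  open (A `&` f @^-1` B).
Proof.
move=> oA oB cf; rewrite openE => x [Ax Bfx].
exact: filterI (open_nbhs_nbhs (conj oA Ax)) (nbhs_continuous (cf x Ax) oB Bfx).
Qed.

Lemma open_chart (W : set (Cn R n)) : open W -> open (cdom c `&` cmap c @^-1` W).
Proof.
move=> oW; apply: open_preim; [exact: cdom_open|exact: oW|exact: cmap_continuous].
Qed.

Lemma cinv_open (W : set (Cn R n)) : W `<=` ccod c ->
  cinv c @` W = cdom c `&` cmap c @^-1` W.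
Proof.
move=> sW; apply/seteqP; split=> [_ [p Wp <-]|x [cx Wx]].
  by split; [apply: cinv_dom; exact: sW|rewrite /= cinvK//; exact: sW].
by exists (cmap c x) => //; rewrite cmapK.
Qed.

End ChartTopology.

Section Differentials.
Variables (R : realType) (n : nat) (M : complexManifold R n).
Implicit Type c : chart R n M.

Lemma transition_open c c' : open (ccod c `&` cinv c @^-1` cdom c').
Proof.
apply: open_preim; [exact: ccod_open|exact: cdom_open|exact: cinv_continuous].
Qed.

Lemma transition_diff c c' p : atlas c -> atlas c' -> ccod c p -> cdom c' (cinv c p) ->
  differentiable (cmap c' \o cinv c) p.
Proof.
move=> ac ac' cp cp'; have [+ _] := atlas_holomorphic ac ac'.
by move/smooth_on_diff; apply.
Qed.

Lemma transition_mulI c c' p v : atlas c -> atlas c' -> ccod c p -> cdom c' (cinv c p) ->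
  'd (cmap c' \o cinv c) p (mulI v) = mulI ('d (cmap c' \o cinv c) p v).
Proof. by move=> ac ac' cp cp'; have [_] := atlas_holomorphic ac ac'; apply. Qed.

(** Continuity is a separate clause: [cmap] is arbitrary off its domain, so differentiability of the
    coordinate expression does not keep [g] inside the chart near [p]. *)
Definition mdifferentiable d (g : Cn R d -> M) p :=
  {for p, continuous g} /\ differentiable (cmap (chart_at (g p)) \o g) p.

Lemma change_chart d (g : Cn R d -> M) p c c' : atlas c -> atlas c' ->
  cdom c (g p) -> cdom c' (g p) -> {for p, continuous g} ->
  differentiable (cmap c \o g) p ->
  differentiable (cmap c' \o g) p /\
  'd (cmap c' \o g) p = 'd (cmap c' \o cinv c) (cmap c (g p)) \o 'd (cmap c \o g) p
    :> (_ -> _).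
Proof.
move=> ac ac' cg cg' ctg dg.
have dt : differentiable (cmap c' \o cinv c) (cmap c (g p)).
  by apply: transition_diff => //; [exact: cmap_cod|rewrite cmapK].
have dc : differentiable ((cmap c' \o cinv c) \o (cmap c \o g)) p.
  by apply: differentiable_comp.
have E : \forall q \near p, ((cmap c' \o cinv c) \o (cmap c \o g)) q = (cmap c' \o g) q.
  have := nbhs_continuous ctg (@cdom_open _ _ _ c) cg.
  by apply: filterS => q cq /=; rewrite cmapK.
have [d1 d2] := near_eq_diff E dc; split; first exact: d1.
exact: etrans d2 (diff_comp dg dt).
Qed.

Lemma mdifferentiableP d (g : Cn R d -> M) p c : atlas c -> cdom c (g p) ->
  mdifferentiable g p <-> {for p, continuous g} /\ differentiable (cmap c \o g) p.
Proof.
move=> ac cg; split=> -[ctg dg]; split=> //.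
  have [] // := change_chart (chart_at_atlas (g p)) ac _ cg ctg dg.
  exact: chart_at_dom.
have [] // := change_chart ac (chart_at_atlas (g p)) cg _ ctg dg.
exact: chart_at_dom.
Qed.

Lemma pdiff_lin d (g : Cn R d -> M) p : lin_fun (pdiff g p).
Proof. exact: diff_lin_fun. Qed.

Lemma pdiff_chart d (g : Cn R d -> M) p c : atlas c -> cdom c (g p) ->
  mdifferentiable g p ->
  pdiff g p = pdiff (cinv c) (cmap c (g p)) \o 'd (cmap c \o g) p.
Proof.
move=> ac cg mg; have [ctg dg] := (mdifferentiableP ac cg).1 mg.
have [_] := change_chart ac (chart_at_atlas (g p)) cg (chart_at_dom _) ctg dg.
by rewrite /pdiff cmapK.
Qed.

Lemma cinv_mdiff c p : atlas c -> ccod c p -> mdifferentiable (cinv c) p.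
Proof.
move=> ac cp; split; first exact: cinv_continuous.
apply: transition_diff => //; first exact: chart_at_atlas.
exact: chart_at_dom.
Qed.

Lemma diff_cmapK c p : ccod c p -> 'd (cmap c \o cinv c) p = id :> (_ -> _).
Proof.
move=> cp; have [did E] := is_diff_id p.
have H : \forall q \near p, id q = (cmap c \o cinv c) q.
  have := open_nbhs_nbhs (conj (@ccod_open _ _ _ c) cp).
  by apply: filterS => q cq /=; rewrite cinvK.
have [_ E2] := near_eq_diff H did.
exact: etrans E2 E.
Qed.

(** Tangent vectors at a point are written in its preferred chart; the differential of [cinv c] and
    the map inverting it here translate to and from the coordinates of [c]. The other composite is
    [cinv_pdiffK]. *)
Lemma pdiff_cinvK c p v : atlas c -> ccod c p ->
  'd (cmap c \o cinv (chart_at (cinv c p))) (cmap (chart_at (cinv c p)) (cinv c p))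
    (pdiff (cinv c) p v) = v.
Proof.
move=> ac cp; set x := cinv c p; set c' := chart_at x.
have cx : cdom c' x by exact: chart_at_dom.
have [] := cinv_mdiff ac cp; rewrite -/x -/c' => ct dg.
have [_ H] := change_chart (chart_at_atlas x) ac cx (cinv_dom cp) ct dg.
exact: (congr1 (@^~ v) (etrans (esym H) (diff_cmapK cp))).
Qed.

Lemma pdiff_cinv_inj c p : atlas c -> ccod c p -> injective (pdiff (cinv c) p).
Proof.
move=> ac cp u v E; rewrite -(pdiff_cinvK u ac cp) -(pdiff_cinvK v ac cp).
by congr ('d _ _ _).
Qed.

Lemma cinv_pdiffK c p v : atlas c -> ccod c p ->
  pdiff (cinv c) p ('d (cmap c \o cinv (chart_at (cinv c p)))
     (cmap (chart_at (cinv c p)) (cinv c p)) v) = v.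
Proof.
move=> ac cp; set x := cinv c p; set c' := chart_at x.
have cx : cdom c' x by exact: chart_at_dom.
have ac' : atlas c' by exact: chart_at_atlas.
have cx' := cmap_cod cx.
have E : cinv c' (cmap c' x) = x by exact: cmapK.
have [ct dg] := cinv_mdiff ac' cx'.
have dg1 : differentiable (cmap c \o cinv c') (cmap c' x).
  by apply: transition_diff => //; rewrite E; exact: cinv_dom.
rewrite /pdiff -/c'.
have cE : cdom c (cinv c' (cmap c' x)) by rewrite E; exact: cinv_dom.
have cE' : cdom c' (cinv c' (cmap c' x)) by rewrite E.
have [_ H] := change_chart ac ac' cE cE' ct dg1.
rewrite E cinvK// in H.
exact: (congr1 (@^~ v) (etrans (esym H) (diff_cmapK cx'))).
Qed.

Lemma pdiff_cinv_mulI c p v : atlas c -> ccod c p ->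
  pdiff (cinv c) p (mulI v) = mulI (pdiff (cinv c) p v).
Proof.
move=> ac cp; apply: transition_mulI => //; first exact: chart_at_atlas.
exact: chart_at_dom.
Qed.

(** In the preferred chart the translation is the identity, so pointwise linear algebra is done in
    that chart. *)
Lemma pdiff_cinv_at (x : M) v : pdiff (cinv (chart_at x)) (cmap (chart_at x) x) v = v.
Proof.
have cx : cdom (chart_at x) x := chart_at_dom x.
rewrite /pdiff cmapK//.
exact: (congr1 (@^~ v) (diff_cmapK (cmap_cod cx))).
Qed.

Lemma smooth_from_open d (W : set (Cn R d)) (g : Cn R d -> M) c : open W ->
  smooth_from W g -> open (W `&` g @^-1` cdom c).
Proof. by move=> oW [ctg _]; apply: open_preim => //; exact: cdom_open. Qed.

Lemma smooth_from_mdiff d (W : set (Cn R d)) (g : Cn R d -> M) p :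
  smooth_from W g -> W p -> mdifferentiable g p.
Proof.
move=> [ctg sg] Wp; split; first exact: ctg.
apply: (smooth_on_diff (sg _ (chart_at_atlas (g p)))).
by split=> //; exact: chart_at_dom.
Qed.

End Differentials.

Section Maps.
Variables (R : realType) (n m : nat) (M : complexManifold R n) (B : complexManifold R m).
Variable f : B -> M.

Lemma mdiffE (x : B) : mdiff f x = pdiff (f \o cinv (chart_at x)) (cmap (chart_at x) x).
Proof. by rewrite /mdiff /pdiff /= cmapK//; exact: chart_at_dom. Qed.

Lemma mdiff_lin (x : B) : lin_fun (mdiff f x).
Proof. exact: diff_lin_fun. Qed.

Hypothesis sf : smooth_map f.

Lemma smooth_map_mdiff c p : atlas c -> ccod c p -> mdifferentiable (f \o cinv c) p.
Proof. by move=> ac cp; exact: smooth_from_mdiff (sf ac) cp. Qed.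

Lemma smooth_map_continuous : continuous f.
Proof.
move=> x; set c := chart_at x.
have cx : cdom c x by exact: chart_at_dom.
have [H _] := smooth_map_mdiff (chart_at_atlas x) (cmap_cod cx).
have H2 : {for x, continuous ((f \o cinv c) \o cmap c)}.
  by apply: continuous_comp; [exact: cmap_continuous|exact: H].
rewrite /prop_for /continuous_at in H2 *.
have E : \forall y \near x, ((f \o cinv c) \o cmap c) y = f y.
  have := open_nbhs_nbhs (conj (@cdom_open _ _ _ c) cx).
  by apply: filterS => y cy /=; rewrite cmapK.
rewrite -(nbhs_singleton E).
by apply: cvg_trans H2; apply: near_eq_cvg; apply: filterS E => y ->.
Qed.

Lemma chain_rule d (g : Cn R d -> B) p : mdifferentiable g p ->
  mdifferentiable (f \o g) p /\ pdiff (f \o g) p = mdiff f (g p) \o pdiff g p.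
Proof.
move=> [ctg dg]; set c := chart_at (g p); set c' := chart_at (f (g p)).
have cg : cdom c (g p) by exact: chart_at_dom.
have [ctf df] := smooth_map_mdiff (chart_at_atlas (g p)) (cmap_cod cg).
rewrite /= cmapK// -/c' in df.
have dc : differentiable ((cmap c' \o (f \o cinv c)) \o (cmap c \o g)) p.
  by apply: differentiable_comp.
have E : \forall q \near p,
   ((cmap c' \o (f \o cinv c)) \o (cmap c \o g)) q = (cmap c' \o (f \o g)) q.
  have := nbhs_continuous ctg (@cdom_open _ _ _ c) cg.
  by apply: filterS => q cq /=; rewrite cmapK.
have [d1 d2] := near_eq_diff E dc; split.
  split; last exact: d1.
  by apply: continuous_comp; [exact: ctg|exact: smooth_map_continuous].
exact: etrans d2 (diff_comp dg df).
Qed.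

Lemma mdiff_chart cB c q u : atlas cB -> atlas c -> ccod cB q ->
  cdom c (f (cinv cB q)) ->
  mdiff f (cinv cB q) (pdiff (cinv cB) q u) =
  pdiff (cinv c) (cmap c (f (cinv cB q))) ('d (cmap c \o f \o cinv cB) q u).
Proof.
move=> acB ac cq cf.
have [mfg E] := chain_rule (cinv_mdiff acB cq).
have E2 := pdiff_chart (g := f \o cinv cB) ac cf mfg.
exact: (congr1 (@^~ u) (etrans (esym E) E2)).
Qed.

Lemma smooth_map_chart cB c : atlas cB -> atlas c ->
  open (ccod cB `&` (f \o cinv cB) @^-1` cdom c) /\
  smooth_on (ccod cB `&` (f \o cinv cB) @^-1` cdom c) (cmap c \o f \o cinv cB).
Proof.
move=> acB ac; have sfB := sf acB; split; last by case: sfB => _; exact.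
by apply: smooth_from_open sfB; exact: ccod_open.
Qed.

End Maps.

(** * Pullback of forms in coordinates *)

Section Bilinear.
Variables (R : realType).

Definition bil n (b : Cn R n -> Cn R n -> R) : Prop :=
  (forall v, lin_fun (fun u => b u v : R)) /\ (forall u, lin_fun (fun v => b u v : R)).

Lemma bil_be n (b : Cn R n -> Cn R n -> R) u v : bil b ->
  b u v = \sum_i \sum_j co i u * (co j v * b (be R i) (be R j)).
Proof.
move=> [bl br]; rewrite (lin_fun_be (L := fun u => b u v) u (bl v)).
apply: eq_bigr => i _; rewrite (lin_fun_be (L := b (be R i)) v (br _)) scaler_sumr.
by apply: eq_bigr => j _.
Qed.

Variable V : normedModType R.

Lemma derive_prod3 (a b c : V -> R) x v :
  differentiable a x -> differentiable b x -> differentiable c x ->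
  differentiable (fun q => a q * (b q * c q)) x /\
  'D_v (fun q => a q * (b q * c q)) x =
    'D_v a x * (b x * c x) + (a x * ('D_v b x * c x) + a x * (b x * 'D_v c x)).
Proof.
move=> da db dc.
have dbc : differentiable (fun q => b q * c q) x by exact: differentiableM.
have dabc : differentiable (fun q => a q * (b q * c q)) x by exact: differentiableM.
split=> //.
have E1 := deriveM (diff_derivable db) (diff_derivable dc).
have E2 := deriveM (diff_derivable da) (diff_derivable dbc).
apply: etrans (E2 v) _; rewrite [X in _ *: X + _](E1 v).
rewrite -![_ *: _]/(_ * _); ring.
Qed.

Lemma derive_sum2 n (h : 'I_n -> 'I_n -> V -> R) x v :
  (forall i j, differentiable (h i j) x) ->
  differentiable (fun q => \sum_i \sum_j h i j q) x /\
  'D_v (fun q => \sum_i \sum_j h i j q) x = \sum_i \sum_j 'D_v (h i j) x.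
Proof.
move=> dh.
have E : (fun q => \sum_i \sum_j h i j q) = \sum_i \sum_j h i j.
  by apply/funext => q; rewrite fct_sumE; apply: eq_bigr => i _; rewrite fct_sumE.
rewrite E.
have dh1 i : differentiable (\sum_j h i j) x by exact: differentiable_sum.
split; first exact: differentiable_sum.
rewrite derive_sum; last by move=> i; apply: diff_derivable; exact: dh1.
apply: eq_bigr => i _; rewrite derive_sum//.
by move=> j; apply: diff_derivable; exact: dh.
Qed.

End Bilinear.

Section LocalPullback.
Variables (R : realType) (d N : nat).
Variables (w : Cn R N -> Cn R N -> Cn R N -> R).
Hypothesis wbil : forall p, bil (fun u v => w u v p).

Lemma bil_smooth (V : normedModType R) (U : set V) (U' : set (Cn R N)) (a b F : V -> Cn R N) :
  open U -> (forall x, U x -> U' (F x)) ->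
  smooth_on U a -> smooth_on U b -> smooth_on U F ->
  (forall u v, smooth_on U' (w u v)) ->
  smooth_on U (fun x => w (a x) (b x) (F x)).
Proof.
move=> oU FU sa sb sF sw k.
apply: (@Ck_on_eq _ _ _ _ _ (fun x => \sum_i \sum_j
  co i (a x) * (co j (b x) * w (be R i) (be R j) (F x)))) => //.
  by move=> x _; exact: esym (bil_be (a x) (b x) (wbil (F x))).
apply: Ck_on_sum => // i _; apply: Ck_on_sum => // j _.
apply: Ck_onM => //; first by apply: (Ck_on_lin oU (co_lin i)); exact: sa.
apply: Ck_onM => //; first by apply: (Ck_on_lin oU (co_lin j)); exact: sb.
exact: (Ck_on_comp_R oU FU (sF k) (sw (be R i) (be R j) k)).
Qed.

Lemma bil_derive (V : normedModType R) (a b F : V -> Cn R N) x v :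
  differentiable a x -> differentiable b x -> differentiable F x ->
  (forall u v, differentiable (w u v) (F x)) ->
  'D_v (fun x => w (a x) (b x) (F x)) x =
    w ('D_v a x) (b x) (F x) + (w (a x) ('D_v b x) (F x) +
      'D_('D_v F x) (w (a x) (b x)) (F x)).
Proof.
move=> da db dF dw.
pose h i j q := co i (a q) * (co j (b q) * w (be R i) (be R j) (F q)).
have E : (fun x => w (a x) (b x) (F x)) = fun q => \sum_i \sum_j h i j q.
  by apply/funext => q; exact: (bil_be (a q) (b q) (wbil (F q))).
have dwF i j : differentiable (fun q => w (be R i) (be R j) (F q)) x.
  exact: (differentiable_comp dF (dw _ _)).
have dai i : differentiable (fun q => co i (a q)) x by exact: differentiable_co.
have dbj j : differentiable (fun q => co j (b q)) x by exact: differentiable_co.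
have [_ E1] := derive_sum2 v (fun i j => (derive_prod3 v (dai i) (dbj j) (dwF i j)).1).
have E2 : bil (fun y z => 'D_('D_v F x) (w y z) (F x)).
  have H y z : derivable (w y z) (F x) ('D_v F x) by exact: diff_derivable.
  split=> [z s y y'|y s z z'].
    have -> : w (s *: y + y') z = s \*: w y z + w y' z.
      by apply/funext => q; have [+ _] := wbil q; apply.
    by rewrite deriveD ?deriveZ//; exact: derivableZ.
  have -> : w y (s *: z + z') = s \*: w y z + w y z'.
    by apply/funext => q; have [_] := wbil q; apply.
  by rewrite deriveD ?deriveZ//; exact: derivableZ.
rewrite E; apply: etrans E1 _.
rewrite (bil_be ('D_v a x) (b x) (wbil (F x))) (bil_be (a x) ('D_v b x) (wbil (F x))).
rewrite (bil_be _ _ E2) -!big_split/=; apply: eq_bigr => i _.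
rewrite -!big_split/=; apply: eq_bigr => j _.
have [_ E3] := derive_prod3 v (dai i) (dbj j) (dwF i j).
apply: etrans E3 _.
have -> : 'D_v (fun q => co i (a q)) x = co i ('D_v a x).
  exact: derive_lin_comp (co_lin i) da.
have -> : 'D_v (fun q => co j (b q)) x = co j ('D_v b x).
  exact: derive_lin_comp (co_lin j) db.
congr (_ + (_ + _ * (_ * _))).
have dF' := diff_derivable dF.
have E4 := deriveE v (differentiable_comp dF (dw (be R i) (be R j))).
apply: etrans E4 _.
have E5 := diff_comp dF (dw (be R i) (be R j)).
apply: etrans (congr1 (@^~ v) E5) _ => /=.
apply: etrans (congr1 _ (esym (deriveE v dF))) _.
exact: esym (deriveE _ (dw _ _)).
Qed.

Lemma Schwarz_Cn (U : set (Cn R d)) (F : Cn R d -> Cn R N) x u v : open U -> U x ->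
  smooth_on U F ->
  'D_u (fun y => 'D_v F y) x = 'D_v (fun y => 'D_u F y) x.
Proof.
move=> oU Ux sF; apply: coP => i.
have sFi : Ck_on 2 U (co i \o F) by apply: Ck_on_lin => //; exact: co_lin.
have dd a b : co i ('D_a (fun y => 'D_b F y) x) = 'D_a (fun y => 'D_b (co i \o F) y) x.
  have dD : differentiable (fun y => 'D_b F y) x.
    exact: smooth_on_diff (smooth_on_derive b sF) Ux.
  apply: etrans (esym (derive_lin_comp a (co_lin i) dD)) _.
  apply: near_eq_derive; apply: filterS (open_nbhs_nbhs (conj oU Ux)) => y Uy.
  exact: esym (derive_lin_comp b (co_lin i) (smooth_on_diff sF Uy)).
have SF := @Schwarz _ _ U (co i \o F) x u v oU Ux sFi.
exact: etrans (dd u v) (etrans SF (esym (dd v u))).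
Qed.

(** The algebra behind the commutation of pullback with the exterior derivative. Here [xy] stands
    for the derivative along x of the derivative of the map along y; the six terms with second
    derivatives cancel by symmetry and skewness, and [r], [s], [t] add up to the derivative of the
    form itself. *)
Lemma alternating_cyclic (b : Cn R N -> Cn R N -> R) (x y z xy yx xz zx yz zy : Cn R N)
    (r s t : R) : bil b -> (forall u, b u u = 0) ->
  xy = yx -> xz = zx -> yz = zy -> r - s + t = 0 ->
  b xy z + (b y xz + r) - (b yx z + (b x yz + s)) + (b zx y + (b x zy + t)) = 0.
Proof.
move=> [bl br] balt <- <- <- H.
have bskew u v : b u v = - b v u.
  have := balt (u + v); rewrite (lin_funD (bl _)) !(lin_funD (br _)) !balt.
  by rewrite add0r addr0 => /eqP; rewrite addr_eq0 => /eqP.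
rewrite (bskew y xz); lra.
Qed.

Definition dclosed_at (w : Cn R N -> Cn R N -> Cn R N -> R) p :=
  forall u v z, 'D_u (w v z) p - 'D_v (w u z) p + 'D_z (w u v) p = 0.

End LocalPullback.

Lemma pullback_dclosed (R : realType) (d N : nat)
    (w : Cn R N -> Cn R N -> Cn R N -> R) (U : set (Cn R d)) (F : Cn R d -> Cn R N) x :
  (forall p, bil (fun u v => w u v p)) -> (forall p u, w u u p = 0) ->
  open U -> U x -> smooth_on U F ->
  (forall u v, differentiable (w u v) (F x)) ->
  dclosed_at w (F x) ->
  dclosed_at (fun u v q => w ('D_u F q) ('D_v F q) (F q)) x.
Proof.
move=> wbil walt oU Ux sF dw cw u v z.
have dD a : differentiable (fun q => 'D_a F q) x.
  exact: smooth_on_diff (smooth_on_derive a sF) Ux.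
have dF := smooth_on_diff sF Ux.
have E a b c := @bil_derive _ _ _ wbil _ _ _ _ x c (dD a) (dD b) dF dw.
have K := congr2 +%R (congr2 (fun r s => r - s) (E v z u) (E u z v)) (E u v z).
apply: etrans K _.
have S a b := Schwarz_Cn a b oU Ux sF.
exact: alternating_cyclic (wbil (F x)) (walt (F x)) (S u v) (S u z) (S v z) (cw _ _ _).
Qed.

(** * Forms on manifolds *)

Section RealForms.
Variables (R : realType) (n : nat) (M : complexManifold R n).
Implicit Type w : M -> Cn R n -> Cn R n -> R.

(** Calculus is done on real-valued functions, so complex forms are handled through their real and
    imaginary parts; this is the real counterpart of [coef]. *)
Definition rcoef w (c : chart R n M) (u v p : Cn R n) : R :=
  w (cinv c p) (pdiff (cinv c) p u) (pdiff (cinv c) p v).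

Definition rform w : Prop :=
  [/\ forall x, bil (w x), forall x u, w x u u = 0 &
      forall c, atlas c -> forall u v, smooth_on (ccod c) (rcoef w c u v)].

Definition rclosed w : Prop :=
  forall c, atlas c -> forall p, ccod c p -> dclosed_at (rcoef w c) p.

Lemma rcoef_bil w c p : (forall x, bil (w x)) -> bil (fun u v => rcoef w c u v p).
Proof.
move=> wbil; have [wl wr] := wbil (cinv c p); rewrite /rcoef.
by split=> [v a u u'|u a v v']; rewrite (pdiff_lin (cinv c) p) ?(wl _) ?(wr _).
Qed.

Lemma bilD (b b' : Cn R n -> Cn R n -> R) : bil b -> bil b' ->
  bil (fun u v => b u v + b' u v).
Proof.
move=> [bl br] [bl' br']; split=> [v a u u'|u a v v'].
  by rewrite (bl v) (bl' v) scalerDr addrACA.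
by rewrite (br u) (br' u) scalerDr addrACA.
Qed.

Lemma bilZ (s : R) (b : Cn R n -> Cn R n -> R) : bil b -> bil (fun u v => s * b u v).
Proof.
move=> [bl br]; split=> [v a u u'|u a v v'].
  by rewrite (bl v) mulrDr -![_ *: _]/(_ * _) mulrCA.
by rewrite (br u) mulrDr -![_ *: _]/(_ * _) mulrCA.
Qed.

Lemma rformD w w' : rform w -> rform w' -> rform (fun x u v => w x u v + w' x u v).
Proof.
move=> [b1 a1 s1] [b2 a2 s2]; split=> [x|x u|c ac u v].
- exact: bilD.
- by rewrite a1 a2 addr0.
- by move=> k; apply: Ck_onD; [exact: ccod_open|exact: s1|exact: s2].
Qed.

Lemma rformZ s w : rform w -> rform (fun x u v => s * w x u v).
Proof.
move=> [b1 a1 s1]; split=> [x|x u|c ac u v].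
- exact: bilZ.
- by rewrite a1 mulr0.
- by move=> k; apply: (Ck_onZ s (@ccod_open _ _ _ c)); exact: s1.
Qed.

Lemma rform_mulI w : rform w -> rform (fun x u v => w x (mulI u) (mulI v)).
Proof.
move=> [b1 a1 s1]; split=> [x|x u|c ac u v]; last 1 first.
- move=> k; apply: Ck_on_eq (s1 c ac (mulI u) (mulI v) k); first exact: ccod_open.
  by move=> p cp; rewrite /rcoef !pdiff_cinv_mulI.
- have [bl br] := b1 x.
  by split=> [v a u u'|u a v v']; rewrite mulI_lin ?(bl _) ?(br _).
- exact: a1.
Qed.

Lemma rform_skew w : rform w -> forall x u v, w x u v = - w x v u.
Proof.
move=> [b1 a1 _] x u v; have [bl br] := b1 x.
have := a1 x (u + v); rewrite (lin_funD (bl _)) !(lin_funD (br _)) !a1.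
by rewrite add0r addr0 => /eqP; rewrite addr_eq0 => /eqP.
Qed.

(** The complex structure acting as a derivation on forms. With [rform_mulI] it supplies the pieces
    of the projection to Hodge type (2,0). *)
Lemma rform_derivation w : rform w ->
  rform (fun x u v => w x (mulI u) v + w x u (mulI v)).
Proof.
move=> fw; have [b1 a1 s1] := fw; split=> [x|x u|c ac u v].
- have [bl br] := b1 x; apply: bilD;
  by split=> [v a u u'|u a v v']; rewrite ?mulI_lin ?(bl _) ?(br _).
- by rewrite (rform_skew fw x (mulI u)) addNr.
- move=> k; have H := Ck_onD (@ccod_open _ _ _ c) (s1 c ac (mulI u) v k) (s1 c ac u (mulI v) k).
  apply: Ck_on_eq H; first exact: ccod_open.
  by move=> p cp; rewrite /rcoef !pdiff_cinv_mulI.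
Qed.

End RealForms.

Section PullbackForms.
Variables (R : realType) (n m : nat) (M : complexManifold R n) (B : complexManifold R m).
Variables (f : B -> M) (w : M -> Cn R n -> Cn R n -> R).
Hypotheses (sf : smooth_map f) (fw : rform w).

Let fpull := fun x u v => w (f x) (mdiff f x u) (mdiff f x v).

Lemma rcoef_pullback cB c q u v : atlas cB -> atlas c -> ccod cB q ->
  cdom c (f (cinv cB q)) ->
  rcoef fpull cB u v q =
  rcoef w c ('d (cmap c \o f \o cinv cB) q u) ('d (cmap c \o f \o cinv cB) q v)
    (cmap c (f (cinv cB q))).
Proof.
move=> acB ac cq cf; rewrite /rcoef /fpull.
by rewrite !(mdiff_chart sf _ acB ac cq cf) cmapK.
Qed.

Let overlap (cB : chart R m B) (c : chart R n M) := ccod cB `&` (f \o cinv cB) @^-1` cdom c.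

Lemma rcoef_pullback_derive cB c : atlas cB -> atlas c -> forall u v q, overlap cB c q ->
  rcoef fpull cB u v q =
  rcoef w c ('D_u (cmap c \o f \o cinv cB) q) ('D_v (cmap c \o f \o cinv cB) q)
    ((cmap c \o f \o cinv cB) q).
Proof.
move=> acB ac u v q [cq cf].
have [_ sF] := smooth_map_chart sf acB ac.
have dF := smooth_on_diff sF (conj cq cf).
rewrite (rcoef_pullback _ _ acB ac cq cf).
exact: (congr2 (fun a b => rcoef w c a b _) (esym (deriveE u dF)) (esym (deriveE v dF))).
Qed.

Lemma rform_pullback : rform fpull.
Proof.
have [wbil walt sw] := fw; split=> [x|x u|cB acB u v].
- have [bl br] := wbil (f x); rewrite /fpull.
  by split=> [v a u u'|u a v v']; rewrite (mdiff_lin f x) ?(bl _) ?(br _).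
- exact: walt.
- move=> k; apply: Ck_on_local => q cq.
  (* Smoothness is checked near each [q] in a chart at its image, since no single chart need contain
     the image of [cB]. *)
  pose c := chart_at (f (cinv cB q)).
  have ac : atlas c by exact: chart_at_atlas.
  have [oO sF] := smooth_map_chart sf acB ac.
  exists (overlap cB c); split; first by split=> //; exact: chart_at_dom.
  pose F := cmap c \o f \o cinv cB.
  have H : smooth_on (overlap cB c) (fun q => rcoef w c ('D_u F q) ('D_v F q) (F q)).
    apply: (@bil_smooth _ _ (rcoef w c) _ _ _ (ccod c)) => //.
    - by move=> p; exact: rcoef_bil.
    - by move=> p [_]; exact: cmap_cod.
    - exact: smooth_on_derive.
    - exact: smooth_on_derive.
    - by move=> a b; exact: sw.
  apply: Ck_on_eq (H k) => // p Op.
  exact: esym (rcoef_pullback_derive acB ac u v Op).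
Qed.

Lemma rclosed_pullback : rclosed w -> rclosed fpull.
Proof.
have [wbil walt sw] := fw; move=> clw cB acB q cq u v z.
pose c := chart_at (f (cinv cB q)).
have ac : atlas c by exact: chart_at_atlas.
have [oO sF] := smooth_map_chart sf acB ac.
have Oq : overlap cB c q by split=> //; exact: chart_at_dom.
pose F := cmap c \o f \o cinv cB.
have cF : ccod c (F q) by case: Oq => _; exact: cmap_cod.
have K : dclosed_at (fun u v q => rcoef w c ('D_u F q) ('D_v F q) (F q)) q.
  apply: (pullback_dclosed _ _ oO Oq sF).
  - by move=> p; exact: rcoef_bil.
  - by move=> p a; exact: walt.
  - by move=> a b; exact: smooth_on_diff (sw c ac a b) cF.
  - exact: clw.
have E a b t : 'D_t (rcoef fpull cB a b) q =
    'D_t (fun q => rcoef w c ('D_a F q) ('D_b F q) (F q)) q.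
  apply: near_eq_derive; apply: filterS (open_nbhs_nbhs (conj oO Oq)).
  exact: rcoef_pullback_derive acB ac a b.
have H := congr2 +%R (congr2 (fun r s => r - s) (E v z u) (E u z v)) (E u v z).
exact: etrans H (K u v z).
Qed.

End PullbackForms.

(** * Complex forms as pairs of real forms *)

Section ComplexForms.
Variables (R : realType) (n : nat) (M : complexManifold R n).
Implicit Type w : tensor2 M.

Definition rePart w : M -> Cn R n -> Cn R n -> R := fun x u v => complex.Re (w x u v).
Definition imPart w : M -> Cn R n -> Cn R n -> R := fun x u v => complex.Im (w x u v).

Lemma ReD (z t : R[i]) : complex.Re (z + t) = complex.Re z + complex.Re t.
Proof. by case: z; case: t. Qed.
Lemma ImD (z t : R[i]) : complex.Im (z + t) = complex.Im z + complex.Im t.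
Proof. by case: z; case: t. Qed.
Lemma ReZ (a : R) (z : R[i]) : complex.Re (a%:C%C * z) = a * complex.Re z.
Proof. by case: z => x y; rewrite /= mul0r subr0. Qed.
Lemma ImZ (a : R) (z : R[i]) : complex.Im (a%:C%C * z) = a * complex.Im z.
Proof. by case: z => x y; rewrite /= mul0r addr0. Qed.
Lemma ReI (z : R[i]) : complex.Re ('i%C * z) = - complex.Im z.
Proof. by case: z => x y; rewrite /= mul0r sub0r mul1r. Qed.
Lemma ImI (z : R[i]) : complex.Im ('i%C * z) = complex.Re z.
Proof. by case: z => x y; rewrite /= mul0r mul1r add0r. Qed.
Lemma complex_eq (z t : R[i]) : complex.Re z = complex.Re t ->
  complex.Im z = complex.Im t -> z = t.
Proof. by case: z => a b; case: t => c d /= -> ->. Qed.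

Lemma two_formP w : two_form w <-> rform (rePart w) /\ rform (imPart w).
Proof.
split=> [[wl wr walt sw]|[[b1 a1 s1] [b2 a2 s2]]].
  split; split=> [x|x u|c ac u v].
  - by split=> [v a u u'|u a v v']; rewrite /rePart ?wl ?wr ReD ReZ.
  - by rewrite /rePart walt.
  - by have [] := sw c ac u v.
  - by split=> [v a u u'|u a v v']; rewrite /imPart ?wl ?wr ImD ImZ.
  - by rewrite /imPart walt.
  - by have [] := sw c ac u v.
split=> [x a u u' v|x a u v v'|x u|c ac u v].
- have [bl1 _] := b1 x; have [bl2 _] := b2 x.
  apply: complex_eq; first by rewrite ReD ReZ; exact: bl1.
  by rewrite ImD ImZ; exact: bl2.
- have [_ br1] := b1 x; have [_ br2] := b2 x.
  apply: complex_eq; first by rewrite ReD ReZ; exact: br1.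
  by rewrite ImD ImZ; exact: br2.
- by apply: complex_eq; [exact: a1|exact: a2].
- by split; [exact: s1|exact: s2].
Qed.

Lemma closed_formP w : closed_form w <-> rclosed (rePart w) /\ rclosed (imPart w).
Proof.
split=> [clw|[cl1 cl2]].
  split=> c ac p cp u v z; have := clw c ac p cp u v z.
    by move/(congr1 (@complex.Re R)).
  by move/(congr1 (@complex.Im R)).
move=> c ac p cp u v z; apply: complex_eq.
  exact: cl1 c ac p cp u v z.
exact: cl2 c ac p cp u v z.
Qed.

End ComplexForms.

(** * Constant rank theorem *)

Section ComplexCoordinates.
Variables (R : realType).

Definition toC n (v : Cn R n) : 'rV[R[i]]_n := \row_j (v.1 0 j +i* v.2 0 j)%C.
Definition ofC n (z : 'rV[R[i]]_n) : Cn R n :=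
  (\row_j complex.Re (z 0 j), \row_j complex.Im (z 0 j)).

Lemma toCK n : cancel (@toC n) (@ofC n).
Proof.
by case=> u v; rewrite /ofC /toC; congr (_, _); apply/rowP => j; rewrite !mxE.
Qed.

Lemma ofCK n : cancel (@ofC n) (@toC n).
Proof. by move=> z; apply/rowP => j; rewrite !mxE /=; case: (z 0 j). Qed.

Lemma toC_lin n (a : R) (u v : Cn R n) : toC (a *: u + v) = a%:C%C *: toC u + toC v.
Proof.
apply/rowP => j; rewrite !mxE /=.
by apply: complex_eq; rewrite /= mul0r ?subr0 ?addr0.
Qed.

Lemma toC_mulI n (u : Cn R n) : toC (mulI u) = 'i%C *: toC u.
Proof.
apply/rowP => j; rewrite !mxE /=.
by apply: complex_eq; rewrite /= !mul0r mul1r ?sub0r ?add0r.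
Qed.

Lemma toC0 n : toC (0 : Cn R n) = 0.
Proof. by apply/rowP => j; rewrite !mxE. Qed.

Lemma toC_eq0 n (v : Cn R n) : toC v = 0 -> v = 0.
Proof. by move=> E; apply: (can_inj (@toCK n)); rewrite E toC0. Qed.

Lemma toCD n (u v : Cn R n) : toC (u + v) = toC u + toC v.
Proof. by rewrite -[u]scale1r toC_lin !scale1r. Qed.

Lemma toCZ n (a : R) (u : Cn R n) : toC (a *: u) = a%:C%C *: toC u.
Proof. by rewrite -[a *: u]addr0 toC_lin toC0 addr0. Qed.

(** The complex linear map sending the row [z] to [z A], read on pairs of real rows. *)
Definition cl n m (A : 'M[R[i]]_(n, m)) (v : Cn R n) : Cn R m := ofC (toC v *m A).

Lemma toC_cl n m (A : 'M[R[i]]_(n, m)) v : toC (cl A v) = toC v *m A.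
Proof. exact: ofCK. Qed.

Lemma cl_lin n m (A : 'M[R[i]]_(n, m)) : lin_fun (cl A).
Proof.
move=> a u v; apply: (can_inj (@toCK m)).
by rewrite toC_lin !toC_cl toC_lin mulmxDl scalemxAl.
Qed.

Lemma cl_mulI n m (A : 'M[R[i]]_(n, m)) v : cl A (mulI v) = mulI (cl A v).
Proof.
by apply: (can_inj (@toCK m)); rewrite toC_mulI !toC_cl toC_mulI scalemxAl.
Qed.

Lemma cl_comp n m k (A : 'M[R[i]]_(n, m)) (B : 'M[R[i]]_(m, k)) v :
  cl B (cl A v) = cl (A *m B) v.
Proof. by rewrite /cl ofCK mulmxA. Qed.

Definition complex_linear n m (L : Cn R n -> Cn R m) : Prop :=
  lin_fun L /\ forall v, L (mulI v) = mulI (L v).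

Definition cmx n m (L : Cn R n -> Cn R m) : 'M[R[i]]_(n, m) :=
  \matrix_i toC (L (ofC (delta_mx 0 i))).

Lemma cmxP n m (L : Cn R n -> Cn R m) v : complex_linear L ->
  toC (L v) = toC v *m cmx L.
Proof.
move=> [hL hJ].
have toC_sum k I (r : seq I) (F : I -> Cn R k) :
    toC (\sum_(i <- r) F i) = \sum_(i <- r) toC (F i).
  elim/big_rec2: _ => [|i x y _ <-]; first exact: toC0.
  exact: toCD.
pose e i := ofC (delta_mx 0 i : 'rV[R[i]]_n).
have vE : v = \sum_i (v.1 0 i *: e i + v.2 0 i *: mulI (e i)).
  apply: (can_inj (@toCK n)); rewrite toC_sum [LHS]row_sum_delta.
  apply: eq_bigr => i _; rewrite toC_lin toCZ toC_mulI ofCK scalerA -scalerDl mxE.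
  by congr (_ *: _); apply: complex_eq; rewrite /= !mul0r ?mulr0 ?mulr1 ?subr0 ?addr0 ?add0r.
rewrite {1}vE (lin_fun_sum _ _ hL) toC_sum [RHS]mulmx_sum_row.
apply: eq_bigr => i _; rewrite rowK (lin_funD hL) !(lin_funZ hL) hJ.
rewrite toCD !toCZ toC_mulI scalerA -scalerDl mxE.
by congr (_ *: _); apply: complex_eq; rewrite /= !mul0r ?mulr0 ?mulr1 ?subr0 ?addr0 ?add0r.
Qed.

End ComplexCoordinates.

(** The kernel of [A] lies in that of [A B], and the rank inequality makes their dimensions
    equal. *)
Lemma rank_mul_ker (F : fieldType) n m k (A : 'M[F]_(n, m)) (B : 'M[F]_(m, k)) (z : 'rV[F]_n) :
  (\rank A <= \rank (A *m B))%N -> z *m A *m B = 0 -> z *m A = 0.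
Proof.
move=> rAB zAB.
have sub : (kermx A <= kermx (A *m B))%MS.
  by apply/sub_kermxP; rewrite mulmxA mulmx_ker mul0mx.
have eqr : \rank (kermx A) = \rank (kermx (A *m B)).
  by rewrite !mxrank_ker; congr subn; apply/eqP; rewrite eqn_leq rAB mxrankM_maxl.
have /eqmxP E : (kermx A == kermx (A *m B))%MS by rewrite -(mxrank_leqif_eq sub) eqr.
apply/sub_kermxP; rewrite E; apply/sub_kermxP; by rewrite mulmxA.
Qed.

Lemma diff_subc (R : realType) (V W : normedModType R) (f : V -> W) (c : W) x v :
  differentiable f x -> 'd (fun y => f y - c) x v = 'd f x v.
Proof.
move=> df; apply: etrans (diff_sub (g := cst c) v df (differentiable_cst _ _)) _.
exact: etrans (congr1 (fun w => 'd f x v - w) (congr1 (@^~ v) (diff_cst c x))) (subr0 _).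
Qed.

Lemma diff_lin_compE (R : realType) (V : normedModType R) n (W : normedModType R)
    (f : V -> Cn R n) (L : Cn R n -> W) (x v : V) :
  lin_fun L -> differentiable f x -> 'd (L \o f) x v = L ('d f x v).
Proof. by move=> hL df; have [_ ->] := diff_lin_comp hL df. Qed.

Section ConstantRank.
Variables (R : realType) (N m d : nat) (f : Cn R N -> Cn R m) (D : set (Cn R N)).
Variable p0 : Cn R N.
Hypotheses (oD : open D) (Dp0 : D p0) (sf : smooth_on D f).
Variable A : Cn R N -> 'M[R[i]]_(N, m).
Hypothesis AP : forall p v, D p -> toC ('d f p v) = toC v *m A p.
Hypothesis rkA : forall p, D p -> (\rank (A p) <= \rank (A p0))%N.
Variables (T : 'M[R[i]]_(m, N)) (X : 'M[R[i]]_N).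
Hypotheses (XT : X + A p0 *m T = 1%:M) (XA0 : X *m A p0 = 0).
Variables (E : 'M[R[i]]_(d, N)) (E' : 'M[R[i]]_(N, d)).
Hypotheses (EA0 : E *m A p0 = 0) (EE' : E *m E' = 1%:M).
Hypothesis E'E : forall z : 'rV[R[i]]_N, z *m A p0 = 0 -> z *m E' *m E = z.

(* [A p0] followed by [T] is a projection along [ker (A p0)] and [X] is the
   complementary projection, so that ['d Phi p0 = id]; by the bound on the rank,
   [Phi] maps the fibre of [f] near [p0] onto an open piece of [ker (A p0)], which
   is the image of [E]. *)
Let Phi p := cl X (p - p0) + cl T (f p - f p0).

Let sPhi : smooth_on D Phi.
Proof.
move=> k; apply: Ck_onD => //; apply: (Ck_on_lin oD (cl_lin _)).
  apply: Ck_onB => //; last exact: Ck_on_cst.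
  exact: Ck_on_linear.
by apply: Ck_onB; [exact: oD|exact: sf|exact: Ck_on_cst].
Qed.

Let dPhi p v : D p -> toC ('d Phi p v) = toC v *m (X + A p *m T).
Proof.
move=> Dp; have dfp := smooth_on_diff sf Dp.
have [idp did] := is_diff_id p.
pose s1 : Cn R N -> Cn R N := fun q => q - p0.
pose s2 : Cn R N -> Cn R m := fun q => f q - f p0.
have d1 : differentiable s1 p by exact: differentiableB.
have d2 : differentiable s2 p by exact: differentiableB.
have [dl1 _] := diff_lin_comp (cl_lin X) d1.
have [dl2 _] := diff_lin_comp (cl_lin T) d2.
have E1 : 'd s1 p v = v.
  apply: etrans (diff_subc p0 v idp) _.
  exact: (congr1 (@^~ v) did).
have E2 : 'd s2 p v = 'd f p v by exact: diff_subc.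
have E3 : 'd Phi p v = cl X v + cl T ('d f p v).
  have F1 : 'd (cl X \o s1) p v = cl X v.
    have G1 := diff_lin_compE v (cl_lin X) d1.
    have G2 := congr1 (cl X) E1.
    have G3 := etrans G1 G2.
    exact: G3.
  have F2 : 'd (cl T \o s2) p v = cl T ('d f p v).
    have G1 := diff_lin_compE v (cl_lin T) d2.
    have G2 := congr1 (cl T) E2.
    have G3 := etrans G1 G2.
    exact: G3.
  apply: etrans (diff_add v dl1 dl2) _.
  exact: congr2 F1 F2.
apply: etrans (congr1 (@toC R N) E3) _.
rewrite toCD !toC_cl.
have G := AP v Dp.
rewrite [X in _ + X *m _]G.
by rewrite mulmxDr mulmxA.
Qed.

Let Phi0 : Phi p0 = 0.
Proof.
by rewrite /Phi !subrr (lin_fun0 (cl_lin X)) (lin_fun0 (cl_lin T)) addr0.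
Qed.

Let dPhi0 : 'd Phi p0 = id :> (_ -> _).
Proof.
apply/funext => v; apply: (can_inj (@toCK R N)).
by rewrite dPhi// XT mulmx1.
Qed.

(** The rank is bounded by its value at [p0], and it cannot drop on [O] because ['d Phi] stays
    invertible there. The map [h] is part of the statement since its continuity makes images of [g]
    relatively open in the fibre. *)
Lemma constant_rank_chart : exists (O : set (Cn R N)) (W : set (Cn R d)) (g : Cn R d -> Cn R N)
    (h : Cn R N -> Cn R d),
  [/\ [/\ open O, O p0 & O `<=` D], [/\ open W, W 0 & g 0 = p0],
    [/\ smooth_on W g,
      (forall s, W s -> forall v, 'd g s v = 0 -> v = 0),
      (forall s, W s -> forall v, 'd g s (mulI v) = mulI ('d g s v)) &
      (forall v, 'd f p0 v = 0 -> exists u, 'd g 0 u = v)] &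
    [/\ (forall s, W s -> [/\ O (g s), f (g s) = f p0 & h (g s) = s]),
      (forall p, O p -> {for p, continuous h}) &
      (forall p, O p -> f p = f p0 -> W (h p) /\ g (h p) = p)]].
Proof.
have [ O [G [e [e0 oO Op0 OD [inj GK gO sG]]]]] :=
  inverse_function oD Dp0 sPhi dPhi0.
rewrite Phi0 in GK gO sG.
have cE := @lin_continuous R d _ (cl E) (cl_lin E).
pose W := [set s : Cn R d | `|cl E s - 0| < e].
pose g := G \o cl E.
pose h p := cl (E') (Phi p).
have oW : open W.
  rewrite (_ : W = (fun s => `|cl E s - 0|) @^-1` [set x : R | x < e])//.
  apply: open_comp; last exact: open_lt.
  by move=> v _; apply: continuous_dist; exact: cE.
have W0 : W 0 by rewrite /W/= (lin_fun0 (cl_lin E)) subrr normr0.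
have gO' s : W s -> O (g s) /\ Phi (g s) = cl E s by move=> /gO.
have g0 : g 0 = p0.
  rewrite /g /= (lin_fun0 (cl_lin E)).
  by have [_] := GK p0 Op0; rewrite Phi0.
have sg : smooth_on W g.
  move=> k; apply: (@Ck_on_comp _ _ _ _ _ _ [set y : Cn R N | `|y - 0| < e]) (sG k) => //.
    rewrite (_ : [set y | _] = (fun s : Cn R N => `|s - 0|) @^-1` [set x : R | x < e])//.
    apply: open_comp; last exact: open_lt.
    by move=> v _; exact: (continuous_dist (f := id)).
  by apply: Ck_on_linear; exact: cl_lin.
have dg s : W s -> differentiable g s by exact: smooth_on_diff.
have dPhig s v : W s -> 'd Phi (g s) ('d g s v) = cl E v.
  move=> Ws; have [Og _] := gO' s Ws.
  have dP := smooth_on_diff sPhi (OD _ Og).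
  have Ec := congr1 (@^~ v) (diff_comp (dg s Ws) dP).
  have [dE dEE] := diff_lin_id s (cl_lin E).
  have H : \forall t \near s, cl E t = (Phi \o g) t.
    by apply: filterS (open_nbhs_nbhs (conj oW Ws)) => t /gO'[_ Pt]; exact: esym Pt.
  have [_ E2] := near_eq_diff H dE.
  have G1 := congr1 (@^~ v) (etrans E2 dEE).
  have G2 := etrans (esym Ec) G1.
  exact: G2.
(* The inverse function theorem used is real; complex linearity of the differential of [g] is
   recovered from that of ['d Phi], which is injective. *)
have dgJ s v : W s -> 'd g s (mulI v) = mulI ('d g s v).
  move=> Ws; have [Og _] := gO' s Ws.
  have linP := diff_lin_fun Phi (g s).
  apply/eqP; rewrite -subr_eq0; apply/eqP; apply: (inj _ Og).
  rewrite (lin_funB linP) dPhig// cl_mulI.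
  apply/eqP; rewrite subr_eq0; apply/eqP; apply: (can_inj (@toCK R N)).
  rewrite toC_mulI dPhi; last exact: OD.
  rewrite toC_mulI -scalemxAl -dPhi; last exact: OD.
  by rewrite dPhig.
have dginj s v : W s -> 'd g s v = 0 -> v = 0.
  move=> Ws E0; have H := dPhig s v Ws.
  rewrite E0 (lin_fun0 (diff_lin_fun _ _)) in H.
  by apply: toC_eq0; rewrite -[LHS]mulmx1 -EE' mulmxA -toC_cl -H toC0 mul0mx.
(* Since [X A0 = 0], with [A0] the value at [p0], [(X + A T) A0 = A T A0]; the first factor is
   invertible, so this product has rank at least that of [A] and its kernel is [ker A]. The vector
   lies in that kernel, because ['d Phi] sends it into [ker A0]. *)
have dfg s v : W s -> 'd f (g s) ('d g s v) = 0.
  move=> Ws; have [Og _] := gO' s Ws; have Dg := OD _ Og.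
  set p := g s in Og Dg *; set z := 'd g s v.
  apply: toC_eq0; rewrite AP//.
  have uX : X + A p *m T \in unitmx.
    rewrite -row_free_unit -kermx_eq0; apply/eqP/row_matrixP => i.
    rewrite row0; set r := row i (kermx (X + A p *m T)).
    have r0 : r *m (X + A p *m T) = 0 by rewrite /r -row_mul mulmx_ker row0.
    have : 'd Phi p (ofC r) = 0.
      by apply: toC_eq0; apply: etrans (dPhi (ofC r) Dg) _; rewrite ofCK.
    by move/(inj _ Og)/(congr1 (@toC R N)); rewrite ofCK toC0.
  have EA : (X + A p *m T) *m A p0 = A p *m (T *m A p0).
    by rewrite mulmxDl XA0 add0r mulmxA.
  apply: (@rank_mul_ker _ _ _ _ _ (T *m A p0)).
    rewrite -EA (eqmxMfull (A p0)); first exact: rkA.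
    by rewrite row_full_unit.
  rewrite -mulmxA -EA mulmxA -dPhi// dPhig// toC_cl -mulmxA.
  by rewrite EA0 mulmx0.
(* [W] is star-shaped about 0, so the mean value bound with constant 0 applies on the segment from 0
   to [s]. *)
have fg s : W s -> f (g s) = f p0.
  move=> Ws; apply/eqP; rewrite -subr_eq0 -normr_le0 -g0 -[s in f (g s)]add0r.
  apply: (@mean_value_le R _ m (f \o g)) => // t /andP[t0 t1].
  have Wt : W (0 + t *: s).
    rewrite add0r /W/= subr0 (lin_funZ (cl_lin E)) normrZ ger0_norm//.
    move: Ws; rewrite /W/= subr0; apply: le_lt_trans.
    by rewrite ler_piMl.
  have [Og _] := gO' _ Wt.
  have dfp := smooth_on_diff sf (OD _ Og).
  split; first by apply: differentiable_comp => //; exact: dg.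
  have Ec := congr1 (@^~ s) (diff_comp (dg _ Wt) dfp).
  by have -> := etrans Ec (dfg _ s Wt); rewrite normr0.
exists O, W, g, h; split; first by split.
- by split.
- split.
  + exact: sg.
  + move=> s Ws v; exact: dginj.
  + move=> s Ws v; exact: dgJ.
  + move=> v dv; exists (cl E' v).
    have H := dPhig 0 (cl E' v) W0.
    rewrite g0 in H.
    have H0 := congr1 (@^~ ('d g 0 (cl E' v))) dPhi0.
    have H1 := etrans (esym H0) H.
    apply: etrans H1 _; rewrite cl_comp.
    apply: (can_inj (@toCK R N)); rewrite toC_cl mulmxA; apply: E'E.
    by rewrite -(AP _ Dp0) dv toC0.
split.
- move=> s Ws; have [Og Pg] := gO' s Ws; split=> //; first exact: fg.
  by rewrite /h Pg cl_comp EE' /cl mulmx1 toCK.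
- move=> p Op; apply: (@continuous_comp _ _ _ Phi (cl (E'))).
    exact: (sPhi 0%N) (OD _ Op).
  by apply: lin_continuous; exact: cl_lin.
- move=> p Op fp.
  have [Pe GP] := GK p Op.
  (* On the fibre the [T]-term of [Phi] vanishes, so [Phi p] lies in [ker (A p0)], where [E']
     followed by [E] is the identity. *)
  have EP : cl E (h p) = Phi p.
    rewrite /h cl_comp; apply: (can_inj (@toCK R N)); rewrite toC_cl mulmxA; apply: E'E.
    rewrite /Phi fp subrr (lin_fun0 (cl_lin T)) addr0 toC_cl -mulmxA XA0 mulmx0//.
  by rewrite /W /g /= EP.
Qed.

End ConstantRank.

Lemma constant_rank (R : realType) (N m : nat) (f : Cn R N -> Cn R m) (D : set (Cn R N))
    (p0 : Cn R N) (d := \rank (kermx (cmx ('d f p0)))) :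
  open D -> D p0 -> smooth_on D f ->
  (forall p, D p -> forall v, 'd f p (mulI v) = mulI ('d f p v)) ->
  (forall p, D p -> (\rank (cmx ('d f p)) <= \rank (cmx ('d f p0)))%N) ->
  exists (O : set (Cn R N)) (W : set (Cn R d)) (g : Cn R d -> Cn R N)
    (h : Cn R N -> Cn R d),
  [/\ [/\ open O, O p0 & O `<=` D], [/\ open W, W 0 & g 0 = p0],
    [/\ smooth_on W g,
      (forall s, W s -> forall v, 'd g s v = 0 -> v = 0),
      (forall s, W s -> forall v, 'd g s (mulI v) = mulI ('d g s v)) &
      (forall v, 'd f p0 v = 0 -> exists u, 'd g 0 u = v)] &
    [/\ (forall s, W s -> [/\ O (g s), f (g s) = f p0 & h (g s) = s]),
      (forall p, O p -> {for p, continuous h}) &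
      (forall p, O p -> f p = f p0 -> W (h p) /\ g (h p) = p)]].
Proof.
move=> oD Dp0 sf holf rkf.
have AP p v : D p -> toC ('d f p v) = toC v *m cmx ('d f p).
  by move=> Dp; apply: cmxP; split; [exact: diff_lin_fun|exact: holf].
set A := fun p => cmx ('d f p).
(* The pseudo-inverse [T] satisfies [A T A = A], so [1 - A T] annihilates [A]. The rows of [E] are a
   basis of the kernel, and its pseudo-inverse reads off coordinates in that basis. *)
apply: (@constant_rank_chart R N m d f D p0 oD Dp0 sf A AP rkf (pinvmx (A p0))
  (1%:M - A p0 *m pinvmx (A p0)) _ _ (row_base (kermx (A p0)))
  (pinvmx (row_base (kermx (A p0))))).
- by rewrite subrK.
- by rewrite mulmxBl mul1mx mulmxKpV// subrr.
- by apply/sub_kermxP; rewrite eq_row_base.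
- by apply: mulmxVp; exact: row_base_free.
- by move=> z z0; rewrite mulmxKpV// eq_row_base; apply/sub_kermxP.
Qed.

(** * Regular fibres *)

Section FibreChart.
Variables (R : realType) (N m : nat) (M : complexManifold R N) (B : complexManifold R m).
Variable pi : M -> B.
Hypothesis hpi : holomorphic_map pi.
Variables (c : chart R N M) (cB : chart R m B).
Hypotheses (ac : atlas c) (acB : atlas cB).

Definition local_dom : set (Cn R N) := ccod c `&` (pi \o cinv c) @^-1` cdom cB.
Definition local_map : Cn R N -> Cn R m := cmap cB \o pi \o cinv c.

Let spi : smooth_map pi. Proof. by case: hpi. Qed.

Lemma local_dom_open : open local_dom.
Proof. by have [] := smooth_map_chart spi ac acB. Qed.

Lemma local_map_smooth : smooth_on local_dom local_map.
Proof. by have [] := smooth_map_chart spi ac acB. Qed.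

Lemma local_map_mulI p v : local_dom p ->
  'd local_map p (mulI v) = mulI ('d local_map p v).
Proof.
move=> [cp cpB]; have [_ piJ] := hpi.
have E u := mdiff_chart spi u ac acB cp cpB.
have cq := cmap_cod cpB.
apply: (pdiff_cinv_inj acB cq).
have E1 := E (mulI v).
rewrite (pdiff_cinv_mulI v ac cp) in E1.
have E2 := piJ (cinv c p) (pdiff (cinv c) p v).
have E3 := congr1 (@mulI R m) (E v).
have E4 := etrans (esym E1) (etrans E2 E3).
have E5 := pdiff_cinv_mulI ('d local_map p v) acB cq.
exact: etrans E4 (esym E5).
Qed.

Lemma pdiff_cinv_comp d (g : Cn R d -> Cn R N) s :
  differentiable g s -> ccod c (g s) ->
  pdiff (cinv c \o g) s = pdiff (cinv c) (g s) \o 'd g s.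
Proof.
move=> dg cg; have [_ dc] := cinv_mdiff ac cg.
exact: diff_comp dg dc.
Qed.

(** The last clause says that the tangent space of the fibre is the whole kernel of the
    differential, so that isotropy of the fibre becomes isotropy of the kernel. *)
Lemma fibre_chart (D : set (Cn R N)) p0
    (d := \rank (kermx (cmx ('d local_map p0)))) :
  open D -> D p0 -> D `<=` local_dom ->
  (forall p, D p -> (\rank (cmx ('d local_map p)) <= \rank (cmx ('d local_map p0)))%N) ->
  exists (W : set (Cn R d)) (g : Cn R d -> M),
  [/\ holomorphic_local_param (pi @^-1` [set pi (cinv c p0)]) W g, W 0,
    g 0 = cinv c p0 &
    forall v, 'd local_map p0 v = 0 -> exists u, pdiff g 0 u = pdiff (cinv c) p0 v].
Proof.
move=> oD Dp0 DL rk.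
have sD : smooth_on D local_map by move=> k; apply: Ck_on_sub DL _; exact: local_map_smooth.
have holD p : D p -> forall v, 'd local_map p (mulI v) = mulI ('d local_map p v).
  by move=> /DL Lp v; exact: local_map_mulI.
have [ O [W [g [h [[oO Op0 OD] [oW W0 g0] [sg injg holg kerg] [Wg ch Fh]]]]]] :=
  constant_rank oD Dp0 sD holD rk.
have Lg s : W s -> local_dom (g s) by move=> /Wg[/OD/DL].
have cg s : W s -> ccod c (g s) by move=> /Lg[].
have dg s : W s -> differentiable g s by exact: smooth_on_diff.
have pg s v : W s -> pdiff (cinv c \o g) s v = pdiff (cinv c) (g s) ('d g s v).
  by move=> Ws; exact: (congr1 (@^~ v) (pdiff_cinv_comp (dg s Ws) (cg s Ws))).
exists W, (cinv c \o g); split; [split; [split| ]|exact: W0| | ].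
- exact: oW.
- split=> [s Ws|c' ac'].
    apply: continuous_comp; first exact: (sg 0%N).
    by apply: cinv_continuous; exact: cg.
  have oW' : open (W `&` (cinv c \o g) @^-1` cdom c').
    apply: open_preim => //; first exact: cdom_open.
    move=> s Ws; apply: continuous_comp; first exact: (sg 0%N).
    by apply: cinv_continuous; exact: cg.
  apply: (@smooth_on_comp R _ _ _ _ (ccod c `&` cinv c @^-1` cdom c') g (cmap c' \o cinv c)).
  + exact: oW'.
  + exact: transition_open.
  + by move=> s [Ws cs]; split=> //; exact: cg.
  + by move=> k; apply: Ck_on_sub (sg k) => s [].
  + by have [] := atlas_holomorphic ac ac'.
- move=> s t Ws Wt /= E.
  have E2 : g s = g t by rewrite -(cinvK (cg s Ws)) E cinvK//; exact: cg.
  have [_ _ hs] := Wg s Ws; have [_ _ ht] := Wg t Wt.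
  by rewrite -hs E2.
- move=> s Ws u v E.
  have E1 := etrans (esym (pg s u Ws)) (etrans E (pg s v Ws)).
  have E2 := pdiff_cinv_inj ac (cg s Ws) E1.
  apply/eqP; rewrite -subr_eq0; apply/eqP; apply: (injg s Ws).
  apply: etrans (lin_funB (diff_lin_fun g s) u v) _.
  by apply/eqP; rewrite subr_eq0; apply/eqP.
- move=> W' oW' W'W.
  (* On the fibre inside [O] the map [h] inverts [g], so this open set cuts out of the fibre exactly
     the image of [W']. *)
  pose V := O `&` h @^-1` W'.
  have oV : open V by exact: open_preim.
  have Vc : V `<=` ccod c by move=> p [/OD/DL[]].
  exists (cinv c @` V); first by rewrite cinv_open//; exact: open_chart.
  apply/seteqP; split=> [_ [s W's <-]|x [Fx [p [Op hp] px]]].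
    have Ws := W'W s W's; have [Og fg hg] := Wg s Ws.
    split.
      have [_ L1] := Lg s Ws; have [_ L0] := DL _ Dp0.
      exact: etrans (esym (cmapK L1)) (etrans (congr1 (cinv cB) fg) (cmapK L0)).
    by exists (g s) => //; split=> //=; rewrite hg.
  have fp : local_map p = local_map p0.
    have Fx' : pi (cinv c p) = pi (cinv c p0) by rewrite px; exact: Fx.
    exact: (congr1 (cmap cB) Fx').
  have [Whp ghp] := Fh p Op fp.
  by exists (h p) => //=; rewrite ghp.
- move=> s Ws u.
  have E1 := etrans (pg s (mulI u) Ws) (congr1 (pdiff (cinv c) (g s)) (holg s Ws u)).
  have E2 := etrans E1 (pdiff_cinv_mulI ('d g s u) ac (cg s Ws)).
  exact: etrans E2 (congr1 (@mulI R N) (esym (pg s u Ws))).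
- by rewrite /= g0.
- move=> v /kerg[u gu]; exists u.
  have E1 := etrans (pg 0 u W0) (congr1 (pdiff (cinv c) (g 0)) gu).
  by rewrite g0 in E1.
Qed.

End FibreChart.

(** The one place where the Lagrangian condition on the fibres enters: the parametrization just
    built exhibits a smooth point, so the kernel has dimension n out of 2n and [Omega] vanishes on
    it. *)
Lemma regular_fibre (R : realType) (n m : nat) (M : complexManifold R (2 * n))
    (B : complexManifold R m) (Omega : tensor2 M) (pi : M -> B)
    (c : chart R (2 * n) M) (cB : chart R m B) (D : set (Cn R (2 * n))) p0 :
  lagrangian_fibration Omega pi -> atlas c -> atlas cB ->
  open D -> D p0 -> D `<=` local_dom pi c cB ->
  (forall p, D p -> (\rank (cmx ('d (local_map pi c cB) p)) <=
     \rank (cmx ('d (local_map pi c cB) p0)))%N) ->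
  \rank (cmx ('d (local_map pi c cB) p0)) = n /\
  forall u v, 'd (local_map pi c cB) p0 u = 0 -> 'd (local_map pi c cB) p0 v = 0 ->
    coef Omega c u v p0 = 0.
Proof.
move=> [hpi _ _ hlag] ac acB oD Dp0 DL rk.
have [W [g [par W0 g0 kerg]]] := fibre_chart hpi ac acB oD Dp0 DL rk.
have [dn iso] := hlag _ _ _ _ par 0 W0.
split.
  have := rank_leq_row (cmx ('d (local_map pi c cB) p0)).
  move: dn; rewrite mxrank_ker.
  move: (\rank _) => r; rewrite mul2n -addnn => dn le.
  by rewrite -(subKn le) dn addKn.
move=> u v /kerg[u' Eu] /kerg[v' Ev].
have := iso u' v'; rewrite /ppullback Eu Ev g0.
exact.
Qed.

(** * Vectors orthogonal to the fibres *)

(** A Lagrangian subspace is its own orthogonal: it is contained in it, and both have dimension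
    n. *)
Lemma lagrangian_mx (F : fieldType) N n k (Om : 'M[F]_N) (K : 'M[F]_(k, N))
    (z : 'rV[F]_N) : (N - n = n)%N -> Om \in unitmx -> \rank K = n ->
  K *m Om *m K^T = 0 -> z *m Om *m K^T = 0 -> (z <= K)%MS.
Proof.
move=> Nn uO rK KOK zOK.
have sub : (K <= kermx (Om *m K^T))%MS by apply/sub_kermxP; rewrite mulmxA.
have /eqmxP E : (K == kermx (Om *m K^T))%MS.
  rewrite -(mxrank_leqif_eq sub) mxrank_ker rK eqmxMfull ?row_full_unit//.
  by rewrite mxrank_tr rK Nn.
by rewrite E; apply/sub_kermxP; rewrite mulmxA.
Qed.

(** Double annihilator: a covector that vanishes on the kernel of a linear map factors through the
    map. *)
Lemma annihilator_mx (F : fieldType) n m (A : 'M[F]_(n, m)) (z : 'rV[F]_n) :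
  (forall v : 'rV[F]_n, v *m A = 0 -> z *m v^T = 0) -> exists y : 'rV[F]_m, z = y *m A^T.
Proof.
move=> H; apply/submxP; rewrite submxE; set C := cokermx _; apply/eqP/matrixP => a j.
have zC : z *m col j C = 0.
  rewrite -[col j C]trmxK; apply: H; apply: trmx_inj.
  by rewrite trmx_mul trmxK colE mulmxA mulmx_coker mul0mx trmx0.
have := congr1 (fun B : 'M[F]_(1, 1) => B a 0) zC.
by rewrite colE mulmxA -colE !mxE.
Qed.

Lemma max_nat_on (T : Type) (D : set T) (r : T -> nat) k x0 : D x0 ->
  (forall x, D x -> (r x <= k)%N) -> exists2 x, D x & forall y, D y -> (r y <= r x)%N.
Proof.
move=> Dx0 rk.
pose P i := `[< exists2 x, D x & r x = i >].
have exP : exists i, P i by exists (r x0); apply/asboolP; exists x0.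
have ubP i : P i -> (i <= k)%N by move=> /asboolP[x Dx <-]; exact: rk.
case: (ex_maxnP exP ubP) => i /asboolP[x Dx <-] Hi.
by exists x => // y Dy; apply: Hi; apply/asboolP; exists y.
Qed.

(** * Matrices of complex and real bilinear forms *)

Section ComplexBilinear.
Variables (R : realType) (N : nat) (b : Cn R N -> Cn R N -> R[i]).
Hypotheses (bl : forall (a : R) u u' v, b (a *: u + u') v = a%:C%C * b u v + b u' v)
  (br : forall (a : R) u v v', b u (a *: v + v') = a%:C%C * b u v + b u v')
  (bJl : forall u v, b (mulI u) v = 'i%C * b u v)
  (bJr : forall u v, b u (mulI v) = 'i%C * b u v).

Definition formmx : 'M[R[i]]_N := \matrix_(i, j) b (ofC (delta_mx 0 i)) (ofC (delta_mx 0 j)).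

Lemma formmxP u v : b u v = (toC u *m formmx *m (toC v)^T) 0 0.
Proof.
pose e i : Cn R N := ofC (delta_mx 0 i).
pose L u : Cn R N := ofC (\row_j b u (e j)).
have cL : complex_linear L.
  split=> [a x y|x]; apply: (can_inj (@toCK R N)); apply/rowP => j.
    by rewrite toC_lin !ofCK !mxE bl.
  by rewrite toC_mulI !ofCK !mxE bJl.
pose L' v : Cn R 1 := ofC (\row_(j < 1) b u v).
have cL' : complex_linear L'.
  split=> [a x y|x]; apply: (can_inj (@toCK R 1)); apply/rowP => j.
    by rewrite toC_lin !ofCK !mxE br.
  by rewrite toC_mulI !ofCK !mxE bJr.
have := congr1 (fun z : 'rV[R[i]]_1 => z 0 0) (cmxP v cL').
rewrite ofCK [LHS]mxE => ->; rewrite !mxE; apply: eq_bigr => j _.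
rewrite [RHS]mulrC [(_^T) _ _]mxE; congr (_ * _).
rewrite mxE ofCK mxE.
have := congr1 (fun z : 'rV[R[i]]_N => z 0 j) (cmxP u cL).
rewrite ofCK [LHS]mxE => ->; congr (fun_of_matrix (_ *m _) _ _).
by apply/matrixP => i k; rewrite !mxE; apply: complex_eq.
Qed.

Lemma formmx_unit : (forall u, (forall v, b u v = 0) -> u = 0) -> formmx \in unitmx.
Proof.
move=> nd; rewrite -row_free_unit -kermx_eq0; apply/eqP/row_matrixP => i.
rewrite row0; set r := row i (kermx formmx).
have r0 : r *m formmx = 0 by rewrite /r -row_mul mulmx_ker row0.
have : ofC r = 0 by apply: nd => v; rewrite formmxP ofCK r0 mul0mx mxE.
by move/(congr1 (@toC R N)); rewrite ofCK toC0.
Qed.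

Lemma isotropic_perp n m (L : Cn R N -> Cn R m) h : (N - n = n)%N -> complex_linear L ->
  (forall u, (forall v, b u v = 0) -> u = 0) ->
  \rank (cmx L) = n -> (forall u v, L u = 0 -> L v = 0 -> b u v = 0) ->
  (forall v, L v = 0 -> b h v = 0) -> L h = 0.
Proof.
move=> Nn cL nd rL iso bh.
pose K := kermx (cmx L).
have LK i : L (ofC (row i K)) = 0.
  by apply: toC_eq0; rewrite cmxP// ofCK /K -row_mul mulmx_ker row0.
have /sub_kermxP : (toC h <= K)%MS.
  apply: (lagrangian_mx Nn (formmx_unit nd)); first by rewrite mxrank_ker rL.
    apply/matrixP => i j; rewrite [RHS]mxE -(iso _ _ (LK i) (LK j)) formmxP !ofCK.
    rewrite -row_mul [LHS]mxE [RHS]mxE; apply: eq_bigr => k _.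
    by rewrite [row i _ _ _]mxE ![_^T _ _]mxE [row j _ _ _]mxE.
  apply/rowP => j; rewrite [RHS]mxE -(bh _ (LK j)) formmxP ofCK.
  rewrite [LHS]mxE [RHS]mxE; apply: eq_bigr => k _.
  by rewrite ![_^T _ _]mxE [row j _ _ _]mxE.
by move=> E; apply: toC_eq0; rewrite cmxP.
Qed.

End ComplexBilinear.

Section RealFormMatrix.
Variables (R : realType) (n : nat) (M : complexManifold R n).
Variables (w : M -> Cn R n -> Cn R n -> R) (c : chart R n M).
Hypothesis wbil : forall x, bil (w x).

Definition rmx (p : Cn R n) : 'M[R]_(n + n) :=
  \matrix_(i, j) rcoef w c (be R i) (be R j) p.

Lemma rmxP p u v : rcoef w c u v p = (flat u *m rmx p *m (flat v)^T) 0 0.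
Proof.
rewrite (bil_be u v (rcoef_bil c p wbil)) mxE.
under [RHS]eq_bigr => j _ do rewrite [(_ *m _) _ _]mxE [_^T _ _]mxE mulr_suml.
rewrite exchange_big /=; apply: eq_bigr => i _; apply: eq_bigr => j _.
by rewrite [rmx p _ _]mxE -mulrA; congr (_ * _); rewrite mulrC.
Qed.

Lemma rmx_unit p : atlas c -> ccod c p ->
  (forall x u, (forall v, w x u v = 0) -> u = 0) -> rmx p \in unitmx.
Proof.
move=> ac cp nd; rewrite -row_free_unit -kermx_eq0; apply/eqP/row_matrixP => i.
rewrite row0; set r := row i (kermx (rmx p)).
have r0 : r *m rmx p = 0 by rewrite /r -row_mul mulmx_ker row0.
have H : pdiff (cinv c) p (unflat r) = 0.
  apply: nd => v.
  have := rmxP p (unflat r) ('d (cmap c \o cinv (chart_at (cinv c p)))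
     (cmap (chart_at (cinv c p)) (cinv c p)) v).
  rewrite unflatK r0 mul0mx [RHS]mxE => <-.
  by rewrite /rcoef cinv_pdiffK.
have H2 : pdiff (cinv c) p (unflat r) = pdiff (cinv c) p 0.
  by rewrite H (lin_fun0 (pdiff_lin _ _)).
have H3 := pdiff_cinv_inj ac cp H2.
by rewrite -[LHS]unflatK H3; exact: (lin_fun0 (@flat_lin R _)).
Qed.

End RealFormMatrix.

(** * The Poisson bracket of functions pulled back from the base *)

Section RegularPoints.
Variables (R : realType) (n m : nat) (M : complexManifold R (2 * n)).
Variables (B : complexManifold R m) (Omega : tensor2 M) (pi : M -> B).
Hypotheses (hO : holomorphic_symplectic Omega) (hpi : lagrangian_fibration Omega pi).

Lemma type20_mulIr x u v : Omega x u (mulI v) = 'i%C * Omega x u v.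
Proof.
have [[ol orr oalt _] _ o20 _ _] := hO.
have skew y z : Omega x y z = - Omega x z y.
  have := oalt x (1 *: y + z); rewrite ol !orr !oalt.
  by rewrite !mul1r !add0r !addr0 => /eqP; rewrite addr_eq0 => /eqP.
by rewrite skew o20 skew mulrN opprK.
Qed.

(** Since [Re Omega(u, J v) = - Im Omega(u, v)], the real part alone determines [Omega]; this
    permits working with real matrices. *)
Lemma re_nondegenerate x u : (forall v, complex.Re (Omega x u v) = 0) -> u = 0.
Proof.
have [_ _ _ _ nd] := hO => H; apply: (nd x) => v.
apply: complex_eq; first exact: H.
by have := H (mulI v); rewrite type20_mulIr ReI => /eqP; rewrite oppr_eq0 => /eqP.
Qed.

Section Local.
Variables (c : chart R (2 * n) M) (cB : chart R m B).
Hypotheses (ac : atlas c) (acB : atlas cB).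
Let f := local_map pi c cB.
Let L := local_dom pi c cB.

Let hol : holomorphic_map pi. Proof. by case: hpi. Qed.

Let reform := rmx (rePart Omega) c.

Let reformP p u v :
  rcoef (rePart Omega) c u v p = (flat u *m reform p *m (flat v)^T) 0 0.
Proof. by apply: rmxP; have [/two_formP[[b1 _ _] _] _ _ _ _] := hO. Qed.

Let reform_unit p : ccod c p -> reform p \in unitmx.
Proof.
move=> cp; apply: rmx_unit => //; last exact: re_nondegenerate.
by have [/two_formP[[b1 _ _] _] _ _ _ _] := hO.
Qed.

(** Row i is ['d f] applied to the Hamiltonian vector, for [Re Omega], of the i-th real coordinate
    of [f]. These vectors span the orthogonal of [ker 'd f], so vanishing means that this orthogonal
    lies in [ker 'd f]. *)
Definition poisson (p : Cn R (2 * n)) :=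
  (lmx ('d f p))^T *m invmx (reform p) *m lmx ('d f p).

(** Hamiltonian vectors of the coordinates are orthogonal to [ker 'd f], which is Lagrangian at such
    a point and so contains them. *)
Lemma poisson_regular p : L p -> \rank (cmx ('d f p)) = n ->
  (forall u v, 'd f p u = 0 -> 'd f p v = 0 -> coef Omega c u v p = 0) ->
  poisson p = 0.
Proof.
move=> Lp rk iso; have [cp cpB] := Lp.
have [[ol orr oalt _] _ o20 _ nd] := hO.
have cL : complex_linear ('d f p).
  by split=> [|v]; [exact: diff_lin_fun|exact: (local_map_mulI hol ac acB v Lp)].
have lin := pdiff_lin (cinv c) p.
have bl (a : R) u u' v : coef Omega c (a *: u + u') v p =
    a%:C%C * coef Omega c u v p + coef Omega c u' v p.
  by rewrite /coef /ppullback lin ol.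
have br (a : R) u v v' : coef Omega c u (a *: v + v') p =
    a%:C%C * coef Omega c u v p + coef Omega c u v' p.
  by rewrite /coef /ppullback lin orr.
have bJl u v : coef Omega c (mulI u) v p = 'i%C * coef Omega c u v p.
  by rewrite /coef /ppullback pdiff_cinv_mulI// o20.
have bJr u v : coef Omega c u (mulI v) p = 'i%C * coef Omega c u v p.
  by rewrite /coef /ppullback pdiff_cinv_mulI// type20_mulIr.
have bnd u : (forall v, coef Omega c u v p = 0) -> u = 0.
  move=> H; apply: (pdiff_cinv_inj ac cp); rewrite (lin_fun0 lin).
  by apply: (nd (cinv c p)) => v; rewrite -(cinv_pdiffK v ac cp); exact: H.
have N2 : (2 * n - n)%N = n by rewrite mul2n -addnn addnK.
have uO := reform_unit cp.
apply/row_matrixP => i; rewrite row0 /poisson row_mul.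
set z := row i _; pose h : Cn R (2 * n) := unflat z.
have Eh : 'd f p h = 0.
  apply: (isotropic_perp bl br bJl bJr N2 cL bnd rk iso) => v dv.
  (* The kernel is stable under [mulI]; the real statement at [v] and at [mulI v] gives the complex
     one. *)
  have re0 u : 'd f p u = 0 -> complex.Re (coef Omega c h u p) = 0.
    move=> du; apply: etrans (reformP p h u) _.
    rewrite unflatK /z -[row i _ *m reform p]row_mul mulmxKV// -tr_col -trmx_mul.
    have lu := flat_lmx u (diff_lin_fun f p).
    rewrite du (lin_fun0 (@flat_lin R m)) in lu.
    by rewrite colE mulmxA -lu mul0mx trmx0 mxE.
  apply: complex_eq; first exact: re0.
  have dJv : 'd f p (mulI v) = 0.
    have H := cL.2 v; rewrite dv in H; apply: etrans H _.
    exact: (lin_fun0 (@mulI_lin R m)).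
  have := re0 _ dJv; rewrite bJr ReI => /eqP; rewrite oppr_eq0 => /eqP; exact.
have H := flat_lmx h (diff_lin_fun f p).
rewrite unflatK in H; rewrite -H Eh; exact: (lin_fun0 (@flat_lin R m)).
Qed.

Lemma poisson_continuous i j p : L p -> {for p, continuous (fun q => poisson q i j)}.
Proof.
have oL := local_dom_open hol ac acB.
have sf := local_map_smooth hol ac acB.
have [/two_formP[[b1 _ s1] _] _ _ _ _] := hO.
have sA a b : Ck_on 0 L (fun q => lmx ('d f q) a b).
  apply: (@Ck_on_eq _ _ _ _ _ (co b \o (fun q => 'd f q (be R a)))) => //.
    by move=> q _; rewrite mxE.
  apply: (Ck_on_lin oL (co_lin b)); apply: Ck_on_diff => //; exact: sf.
have sO a b : Ck_on 0 L (fun q => invmx (reform q) a b).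
  apply: Ck_on_invmx => // [q [cq _]|a' b']; first exact: reform_unit.
  apply: (@Ck_on_eq _ _ _ _ _ (rcoef (rePart Omega) c (be R a') (be R b'))) => //.
    by move=> q _; rewrite mxE.
  by apply: Ck_on_sub (s1 c ac (be R a') (be R b') 0%N) => q [].
have : Ck_on 0 L (fun q => poisson q i j); last exact.
apply: (@Ck_on_eq _ _ _ _ _ (fun q => \sum_b (\sum_a lmx ('d f q) a i *
   invmx (reform q) a b) * lmx ('d f q) b j)) => //.
  move=> q _; rewrite [RHS]mxE; apply: eq_bigr => b _; congr (_ * _).
  by rewrite [RHS]mxE; apply: eq_bigr => a _; rewrite [_^T _ _]mxE.
apply: Ck_on_sum => // b _; apply: Ck_onM => //.
by apply: Ck_on_sum => // a _; exact: Ck_onM.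
Qed.

(* The Poisson bracket of the components of [pi] vanishes where the rank of
   ['d f] is locally maximal, and such points are dense. *)
Lemma poisson0 p : L p -> poisson p = 0.
Proof.
move=> Lp; apply/matrixP => i j; rewrite [RHS]mxE; apply/eqP/negPn/negP => P0.
have oL := local_dom_open hol ac acB.
pose D := L `&` [set q | poisson q i j != 0].
have oD : open D.
  rewrite openE => q [Lq Pq].
  have H : \forall x \near q, poisson x i j != 0.
    exact: cvgr_neq0 (@poisson_continuous i j q Lq) Pq.
  exact: filterI (open_nbhs_nbhs (conj oL Lq)) H.
(* The rank is a bounded integer, so it has a maximum on [D]. As [D] is open, [regular_fibre]
   applies at a maximizer, and the bracket vanishes there, contrary to the definition of [D]. *)
have [|q Dq maxq] := @max_nat_on _ D (fun q => \rank (cmx ('d f q))) (2 * n) p (conj Lp P0).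
  by move=> q _; exact: rank_leq_row.
have DL : D `<=` L by move=> x [].
have [rk iso] := regular_fibre hpi ac acB oD Dq DL maxq.
have [Lq] := Dq; rewrite /= (poisson_regular Lq rk iso) mxE => /eqP; exact.
Qed.

End Local.

(** The covector [Re Omega(h, .)] kills the kernel, hence factors through [d pi]. This writes [h] as
    a combination of Hamiltonian vectors of base coordinates, which [d pi] kills by [poisson0],
    whatever its rank. *)
Lemma lagrangian_perp x h :
  (forall v, mdiff pi x v = 0 -> complex.Re (Omega x h v) = 0) -> mdiff pi x h = 0.
Proof.
move=> H; pose c := chart_at x; pose cB := chart_at (pi x).
have ac : atlas c := chart_at_atlas x; have acB : atlas cB := chart_at_atlas (pi x).
have cx : cdom c x := chart_at_dom x.
pose p := cmap c x; have cp : ccod c p := cmap_cod cx.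
have Lp : local_dom pi c cB p.
  by split=> //; rewrite /preimage/= cmapK//; exact: chart_at_dom.
have b1 : forall x, bil (rePart Omega x).
  by have [/two_formP[[b1 _ _] _] _ _ _ _] := hO.
have uO := rmx_unit b1 ac cp re_nondegenerate.
pose A := lmx ('d (local_map pi c cB) p).
have [|y Ey] := @annihilator_mx _ _ _ A (flat h *m rmx (rePart Omega) c p).
  move=> v vA; apply/matrixP => a b; rewrite !ord1 [RHS]mxE.
  have := rmxP c b1 p h (unflat v); rewrite unflatK => <-.
  rewrite /rcoef /rePart !pdiff_cinv_at cmapK//; apply: H.
  have E := flat_lmx (unflat v) (diff_lin_fun (local_map pi c cB) p).
  rewrite unflatK vA in E.
  have E2 := congr1 (@unflat R m) E; rewrite flatK in E2.
  by apply: etrans E2 _; exact: (lin_fun0 (@unflat_lin R m)).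
have E := flat_lmx h (diff_lin_fun (local_map pi c cB) p).
have E2 : flat h *m A = 0.
  rewrite -(mulmxK uO (flat h)) Ey -!mulmxA.
  have := poisson0 ac acB Lp; rewrite /poisson -/A -mulmxA => ->.
  exact: mulmx0.
have E3 := congr1 (@unflat R m) (etrans E E2); rewrite flatK in E3.
by apply: etrans E3 _; exact: (lin_fun0 (@unflat_lin R m)).
Qed.

End RegularPoints.

(** * Operations on forms and Hodge types *)

Section FormOperations.
Variables (R : realType) (n : nat) (M : complexManifold R n).
Implicit Type w : tensor2 M.

Lemma ReN (z : R[i]) : complex.Re (- z) = - complex.Re z. Proof. by case: z. Qed.
Lemma ImN (z : R[i]) : complex.Im (- z) = - complex.Im z. Proof. by case: z. Qed.

Lemma two_formD w w' : two_form w -> two_form w' ->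
  two_form (fun x u v => w x u v + w' x u v).
Proof.
move=> /two_formP[r1 i1] /two_formP[r2 i2]; apply/two_formP; split.
  rewrite (_ : rePart _ = fun x u v => rePart w x u v + rePart w' x u v).
    exact: rformD.
  by apply/funext => x; apply/funext => u; apply/funext => v; exact: ReD.
rewrite (_ : imPart _ = fun x u v => imPart w x u v + imPart w' x u v).
  exact: rformD.
by apply/funext => x; apply/funext => u; apply/funext => v; exact: ImD.
Qed.

Lemma two_formN w : two_form w -> two_form (fun x u v => - w x u v).
Proof.
move=> /two_formP[r1 i1]; apply/two_formP; split.
  rewrite (_ : rePart _ = fun x u v => -1 * rePart w x u v); first exact: rformZ.
  by apply/funext => x; apply/funext => u; apply/funext => v; rewrite mulN1r; exact: ReN.
rewrite (_ : imPart _ = fun x u v => -1 * imPart w x u v); first exact: rformZ.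
by apply/funext => x; apply/funext => u; apply/funext => v; rewrite mulN1r; exact: ImN.
Qed.

Lemma two_form_skew w : two_form w -> forall x u v, w x u v = - w x v u.
Proof.
move=> /two_formP[r1 i1] x u v; apply: complex_eq.
  by rewrite ReN; exact: (rform_skew r1).
by rewrite ImN; exact: (rform_skew i1).
Qed.

Lemma two_formNl w : two_form w -> forall x u v, w x (- u) v = - w x u v.
Proof.
move=> tw x u v; have /two_formP[[b1 _ _] [b2 _ _]] := tw.
have [bl1 _] := b1 x; have [bl2 _] := b2 x.
apply: complex_eq; first by rewrite ReN; exact: lin_funN (bl1 v) u.
by rewrite ImN; exact: lin_funN (bl2 v) u.
Qed.

Lemma two_formNr w : two_form w -> forall x u v, w x u (- v) = - w x u v.
Proof.
by move=> tw x u v; rewrite (two_form_skew tw) (two_formNl tw) -(two_form_skew tw).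
Qed.

Lemma rclosedN (w : M -> Cn R n -> Cn R n -> R) : rform w -> rclosed w ->
  rclosed (fun x u v => - w x u v).
Proof.
move=> [_ _ s1] clw c ac p cp u v z.
have E a b t : 'D_t (rcoef (fun x u v => - w x u v) c a b) p = - 'D_t (rcoef w c a b) p.
  apply: (@deriveN _ _ _ (rcoef w c a b)); apply: diff_derivable.
  exact: smooth_on_diff (s1 c ac a b) cp.
have H := congr2 +%R (congr2 (fun r s => r - s) (E v z u) (E u z v)) (E u v z).
apply: etrans H _.
have := congr1 -%R (clw c ac p cp u v z); rewrite oppr0 => <-.
by rewrite !opprD !opprK.
Qed.

Lemma closed_formN w : two_form w -> closed_form w -> closed_form (fun x u v => - w x u v).
Proof.
move=> /two_formP[r1 i1] /closed_formP[cr ci]; apply/closed_formP; split.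
  rewrite (_ : rePart _ = fun x u v => - rePart w x u v); first exact: rclosedN.
  by apply/funext => x; apply/funext => u; apply/funext => v; exact: ReN.
rewrite (_ : imPart _ = fun x u v => - imPart w x u v); first exact: rclosedN.
by apply/funext => x; apply/funext => u; apply/funext => v; exact: ImN.
Qed.

Lemma two_form_pullback m (B : complexManifold R m) (f : B -> M) w :
  smooth_map f -> two_form w -> two_form (pullback f w).
Proof.
move=> sf /two_formP[r1 i1]; apply/two_formP.
split; [exact: rform_pullback sf r1|exact: rform_pullback sf i1].
Qed.

Lemma closed_form_pullback m (B : complexManifold R m) (f : B -> M) w :
  smooth_map f -> two_form w -> closed_form w -> closed_form (pullback f w).
Proof.
move=> sf /two_formP[r1 i1] /closed_formP[cr ci]; apply/closed_formP.
split; [exact: rclosed_pullback sf r1 cr|exact: rclosed_pullback sf i1 ci].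
Qed.

(** The hypothesis is the vanishing of [w] on the pairs of (0,1)-vectors [u + i J u],
    [v + i J v]. *)
Lemma type20_11_intro w : two_form w ->
  (forall x u v, w x u v + 'i%C * w x (mulI u) v + 'i%C * w x u (mulI v)
     - w x (mulI u) (mulI v) = 0) ->
  type20_11 w.
Proof.
move=> tw w02.
pose q : R[i] := (4^-1)%:C%C.
have q4 : q * 4 = 1.
  rewrite (_ : 4 = (4 : R)%:C%C); last by rewrite rmorph_nat.
  by rewrite -rmorphM /= mulVf// pnatr_eq0.
have sqr_i : 'i%C * 'i%C = -1 :> R[i] by rewrite -expr2 sqr_i.
(* [w] evaluated on the (1,0)-projections [(u - i J u) / 2] and [(v - i J v) / 2], whence the factor
   1/4. *)
pose a : tensor2 M := fun x u v => q * (w x u v - w x (mulI u) (mulI v)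
  - 'i%C * (w x (mulI u) v + w x u (mulI v))).
have ta : two_form a.
  have /two_formP[r1 i1] := tw.
  apply/two_formP; split.
    rewrite (_ : rePart a = fun x u v => 4^-1 * (rePart w x u v +
      (-1 * rePart w x (mulI u) (mulI v) + (imPart w x (mulI u) v + imPart w x u (mulI v))))).
      apply: rformZ; apply: rformD => //; apply: rformD; last exact: rform_derivation.
      by apply: rformZ; exact: rform_mulI.
    apply/funext => x; apply/funext => u; apply/funext => v.
    rewrite /rePart /a ReZ; congr (_ * _).
    by rewrite ReD ReD !ReN ReI ImD opprK mulN1r -addrA.
  rewrite (_ : imPart a = fun x u v => 4^-1 * (imPart w x u v +
      (-1 * imPart w x (mulI u) (mulI v) + -1 * (rePart w x (mulI u) v + rePart w x u (mulI v))))).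
    apply: rformZ; apply: rformD => //; apply: rformD; apply: rformZ.
      exact: rform_mulI.
    exact: rform_derivation.
  apply/funext => x; apply/funext => u; apply/funext => v.
  rewrite /imPart /a ImZ; congr (_ * _).
  by rewrite ImD ImD !ImN ImI ReD !mulN1r -addrA.
exists a, (fun x u v => w x u v + - a x u v); split.
- exact: ta.
- by apply: two_formD => //; exact: two_formN.
- move=> x u v; rewrite /a mulIK !(two_formNl tw).
  move: (w x u v) (w x (mulI u) v) (w x u (mulI v)) (w x (mulI u) (mulI v)) => A B C D.
  apply/eqP; rewrite -subr_eq0; apply/eqP.
  rewrite -[X in _ - X * _]/('i%C : R[i]).
  rewrite (_ : _ - _ = q * (B + C) * ('i%C * 'i%C + 1)); last by ring.
  by rewrite sqr_i addNr mulr0.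
(* Removing the (2,0)-part leaves types (1,1) and (0,2), on which [J] acts by 1 and -1; the
   hypothesis excludes the second. *)
- move=> x u v; rewrite /a !mulIK !(two_formNl tw) !(two_formNr tw).
  have := w02 x u v.
  move: (w x u v) (w x (mulI u) v) (w x u (mulI v)) (w x (mulI u) (mulI v)) => A B C D H.
  apply/eqP; rewrite -subr_eq0; apply/eqP.
  rewrite (_ : _ - _ = (D - A) * (1 - q * 4) - 2 * q * (A + 'i%C * B + 'i%C * C - D)).
    by rewrite H q4 subrr !mulr0 subr0.
  by ring.
- by move=> x u v; rewrite addrC subrK.
Qed.

End FormOperations.

(** * The translated symplectic form *)

Lemma near_eq_pdiff (R : realType) n (M : complexManifold R n) d (g g' : Cn R d -> M) p :
  (\forall q \near p, g q = g' q) -> mdifferentiable g p -> pdiff g p = pdiff g' p.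
Proof.
move=> E [_ dg].
have E2 : \forall q \near p, (cmap (chart_at (g p)) \o g) q = (cmap (chart_at (g p)) \o g') q.
  by apply: filterS E => q /= ->.
have [_ H] := near_eq_diff E2 dg.
by rewrite /pdiff -(nbhs_singleton E); exact: esym H.
Qed.

Section Main.
Variables (R : realType) (n m : nat).
Variables (M : complexManifold R (2 * n)) (B : complexManifold R m).
Variables (Omega : tensor2 M) (pi : M -> B) (S : B -> M).
Hypotheses (hOmega : holomorphic_symplectic Omega).
Hypotheses (hpi : lagrangian_fibration Omega pi).
Hypotheses (hS : smooth_map S).
Hypotheses (hsection : forall b, pi (S b) = b).

Let tO : two_form Omega. Proof. by case: hOmega. Qed.
Let spi : smooth_map pi. Proof. by case: hpi => [[]]. Qed.
Let piJ x u : mdiff pi x (mulI u) = mulI (mdiff pi x u).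
Proof. by case: hpi => [[_ H] _ _ _]; exact: H. Qed.
Let O20 x u v : Omega x (mulI u) v = 'i%C * Omega x u v.
Proof. by case: hOmega => _ _ H _ _; exact: H. Qed.

Lemma mdiff_section b u : mdiff pi (S b) (mdiff S b u) = u.
Proof.
have cb : cdom (chart_at b) b := chart_at_dom b.
pose q := cmap (chart_at b) b.
have cq : ccod (chart_at b) q := cmap_cod cb.
have mS := smooth_map_mdiff hS (chart_at_atlas b) cq.
have [_ E] := chain_rule spi mS.
have E2 : pi \o (S \o cinv (chart_at b)) = cinv (chart_at b).
  by apply/funext => p; exact: hsection.
rewrite E2 in E.
have E3 := congr1 (@^~ u) E.
have E4 := etrans (esym E3) (pdiff_cinv_at b u).
have E5 : mdiff pi (S (cinv (chart_at b) q)) (pdiff (S \o cinv (chart_at b)) q u) = u.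
  exact: E4.
have qb : cinv (chart_at b) q = b by exact: cmapK.
rewrite qb in E5.
have E6 := congr1 (@^~ u) (mdiffE S b).
have E7 := etrans (congr1 (mdiff pi (S b)) E6) E5.
exact: E7.
Qed.

(** As [d pi] is onto at [S b], its rank there is the dimension of the target, the largest possible,
    and [regular_fibre] applies on the whole overlap of charts. That the base has dimension n is
    derived here. *)
Lemma section_fibre b : m = n /\
  forall u v, mdiff pi (S b) u = 0 -> mdiff pi (S b) v = 0 -> Omega (S b) u v = 0.
Proof.
pose x := S b; pose c := chart_at x; pose cB := chart_at (pi x).
have ac : atlas c := chart_at_atlas x; have acB : atlas cB := chart_at_atlas (pi x).
have cx : cdom c x := chart_at_dom x.
pose p := cmap c x; have cp : ccod c p := cmap_cod cx.
have Lp : local_dom pi c cB p.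
  by split=> //; rewrite /preimage/= cmapK//; exact: chart_at_dom.
have hol : holomorphic_map pi by case: hpi.
have cL : complex_linear ('d (local_map pi c cB) p).
  by split=> [|v]; [exact: diff_lin_fun|exact: (local_map_mulI hol ac acB v Lp)].
have rk : \rank (cmx ('d (local_map pi c cB) p)) = m.
  apply/eqP; rewrite -[_ == _]/(row_full _) -sub1mx; apply/row_subP => i.
  apply/submxP; exists (toC (mdiff S b (ofC (row i 1%:M)))).
  rewrite -(cmxP _ cL) -[LHS]ofCK; congr toC; apply: esym.
  exact: mdiff_section.
have [rk2 iso] := regular_fibre hpi ac acB (local_dom_open hol ac acB) Lp
   (fun q Lq => Lq) (fun q _ => leq_trans (rank_leq_col _) (eq_leq (esym rk))).
split; first exact: etrans (esym rk) rk2.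
move=> u v du dv; have := iso u v du dv.
by rewrite /coef /ppullback !pdiff_cinv_at cmapK.
Qed.

Definition eta : tensor2 B := fun b u v => - pullback S Omega b u v.

Lemma eta_two_form : two_form eta.
Proof. by apply: two_formN; exact: two_form_pullback. Qed.

Lemma eta_closed : closed_form eta.
Proof.
apply: closed_formN; first exact: two_form_pullback.
by apply: closed_form_pullback => //; case: hOmega.
Qed.

Let Ol x u u' v : Omega x (u + u') v = Omega x u v + Omega x u' v.
Proof.
by case: tO => H _ _ _; rewrite -[u in LHS]scale1r H mul1r.
Qed.

Let Or x u v v' : Omega x u (v + v') = Omega x u v + Omega x u v'.
Proof.
by case: tO => _ H _ _; rewrite -[v in LHS]scale1r H mul1r.
Qed.

(* [u + i J u] is of type (0,1), and [dS (u + i J u)] has vertical (1,0)-part. *)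
Lemma eta_no02 b u v : eta b u v + 'i%C * eta b (mulI u) v + 'i%C * eta b u (mulI v)
     - eta b (mulI u) (mulI v) = 0.
Proof.
pose vert u := mdiff S b u + mulI (mdiff S b (mulI u)).
have vertP w : mdiff pi (S b) (vert w) = 0.
  rewrite /vert (lin_funD (mdiff_lin _ _)) piJ !mdiff_section mulIK subrr//.
have [_ iso] := section_fibre b.
have := iso _ _ (vertP u) (vertP v).
rewrite /vert Ol !Or !O20 !(type20_mulIr hOmega) /eta /pullback => H.
rewrite -[RHS]oppr0 -H.
have sqr_i : 'i%C * 'i%C = -1 :> R[i] by rewrite -expr2 sqr_i.
rewrite [in RHS]mulrA sqr_i; ring.
Qed.

(** * Nondegeneracy and the induced almost complex structure *)

Definition Psi : tensor2 M := fun x u v => Omega x u v + pullback pi eta x u v.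

Lemma Psi_two_form : two_form Psi.
Proof. by apply: two_formD => //; apply: two_form_pullback => //; exact: eta_two_form. Qed.

Let eta0l b y : eta b 0 y = 0.
Proof.
case: eta_two_form => el _ _ _.
have := el b 1 0 0 y; rewrite scaler0 addr0 mul1r => /eqP.
by rewrite -subr_eq0 opprD addrA subrr sub0r oppr_eq0 => /eqP.
Qed.

Let eta0r b y : eta b y 0 = 0.
Proof. by rewrite (two_form_skew eta_two_form) eta0l oppr0. Qed.

(** Against vertical vectors [Psi] agrees with [Omega], so a vector in its kernel is orthogonal to
    [ker d pi], hence vertical; but on a vertical vector [Psi] is [Omega] altogether. *)
Lemma Psi_nondegenerate : Defs.nondegenerate Psi.
Proof.
move=> x u H.
have pu : mdiff pi x u = 0.
  apply: (lagrangian_perp hOmega hpi) => v dv.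
  by have := H v; rewrite /Psi /pullback dv eta0r addr0 => ->.
have [_ _ _ _ nd] := hOmega; apply: (nd x) => v.
by have := H v; rewrite /Psi /pullback pu eta0l addr0.
Qed.

Lemma Psi_inj x u u' : (forall v, Psi x u v = Psi x u' v) -> u = u'.
Proof.
move=> H; apply/eqP; rewrite -subr_eq0; apply/eqP; apply: (Psi_nondegenerate (x := x)) => v.
case: Psi_two_form => pl _ _ _.
by rewrite -[u]scale1r pl mul1r H (two_formNl Psi_two_form) subrr.
Qed.

(* [I u = J u + h] where [h] is the vertical vector with [Omega h = beta]. *)
Lemma Psi_structure x u : exists u', forall v, Psi x u' v = 'i%C * Psi x u v.
Proof.
have tE := eta_two_form.
pose y := pi x; pose du := mdiff pi x u.
pose beta v := 'i%C * eta y du (mdiff pi x v) - eta y (mulI du) (mdiff pi x v).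
have sqr_i : 'i%C * 'i%C = -1 :> R[i] by rewrite -expr2 sqr_i.
(* Complex linearity of [beta] is the absence of a (0,2)-part in [eta]; it lets the equation for [h]
   be solved for real parts only. *)
have betaJ v : beta (mulI v) = 'i%C * beta v.
  rewrite /beta piJ; have := eta_no02 y du (mdiff pi x v).
  set t := mdiff pi x v.
  move: (eta y du t) (eta y (mulI du) t) (eta y du (mulI t)) (eta y (mulI du) (mulI t)).
  move=> A B' C D H.
  apply/eqP; rewrite -subr_eq0; apply/eqP; rewrite -[RHS]H.
  have -> : 'i%C * C - D - 'i%C * ('i%C * A - B') =
    'i%C * C - D - ('i%C * 'i%C) * A + 'i%C * B' by ring.
  by rewrite sqr_i; ring.
have beta0 v : mdiff pi x v = 0 -> beta v = 0.
  by move=> dv; rewrite /beta dv !eta0r mulr0 subr0.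
have betaL : lin_fun (fun v => complex.Re (beta v) : R).
  move=> a v v'; rewrite /beta (mdiff_lin pi x).
  case: tE => _ er _ _; rewrite !er.
  move: (eta _ _ _) (eta _ _ _) (eta _ _ _) (eta _ _ _) => [a1 a2] [b1 b2] [c1 c2] [d1 d2] /=.
  rewrite -[_ *: _]/(_ * _); ring.
have b1 : forall x, bil (rePart Omega x).
  by have /two_formP[[b1 _ _] _] := tO.
pose c := chart_at x; have ac : atlas c := chart_at_atlas x.
have cx : cdom c x := chart_at_dom x.
pose p := cmap c x; have cp : ccod c p := cmap_cod cx.
have uO := rmx_unit b1 ac cp (re_nondegenerate hOmega).
pose h : Cn R (2 * n) := unflat ((\row_j complex.Re (beta (be R j))) *m
   invmx (rmx (rePart Omega) c p)).
have reh v : complex.Re (Omega x h v) = complex.Re (beta v).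
  have := rmxP c b1 p h v.
  rewrite /rcoef /rePart !pdiff_cinv_at cmapK// unflatK mulmxKV// => ->.
  rewrite (lin_fun_be v betaL) mxE; apply: eq_bigr => j _.
  by rewrite mxE [_^T _ _]mxE mulrC.
have hbeta v : Omega x h v = beta v.
  apply: complex_eq; first exact: reh.
  have := reh (mulI v); rewrite (type20_mulIr hOmega) betaJ !ReI.
  by move/oppr_inj.
(* [beta] vanishes on vertical vectors, so [h] is orthogonal to [ker d pi]. *)
have ph : mdiff pi x h = 0.
  by apply: (lagrangian_perp hOmega hpi) => v /beta0 dv; rewrite reh dv.
exists (mulI u + h) => v.
rewrite /Psi /pullback Ol O20 hbeta (lin_funD (mdiff_lin pi x)) piJ ph addr0.
by rewrite /beta mulrDr -addrA subrK.
Qed.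

(** A pointwise choice: existence is [Psi_structure], so the default 0 is never taken, and [Psi_inj]
    makes the value unique, from which its algebraic properties follow. *)
Definition Istruct x u : Cn R (2 * n) :=
  xget 0 [set u' | forall v, Psi x u' v = 'i%C * Psi x u v].

Lemma IstructP x u v : Psi x (Istruct x u) v = 'i%C * Psi x u v.
Proof.
have [u' Hu'] := Psi_structure x u.
exact: (@xgetPex _ 0 [set u' | forall v, Psi x u' v = 'i%C * Psi x u v]) (ex_intro _ u' Hu') v.
Qed.

Lemma Psi_mulIr x u v : Psi x u (Istruct x v) = 'i%C * Psi x u v.
Proof.
rewrite (two_form_skew Psi_two_form) IstructP (two_form_skew Psi_two_form x u).
by rewrite mulrN.
Qed.

Lemma re_Psi_nondegenerate x u : (forall v, complex.Re (Psi x u v) = 0) -> u = 0.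
Proof.
move=> H; apply: (Psi_nondegenerate (x := x)) => v.
apply: complex_eq; first exact: H.
by have := H (Istruct x v); rewrite Psi_mulIr ReI => /eqP; rewrite oppr_eq0 => /eqP.
Qed.

Lemma Istruct_acs : almost_complex_structure Istruct.
Proof.
have sqr_i : 'i%C * 'i%C = -1 :> R[i] by rewrite -expr2 sqr_i.
have tP := Psi_two_form; case: (tP) => pl pr _ _.
split=> [x a u v|x u|c ac u].
- apply: (Psi_inj (x := x)) => z; rewrite IstructP !pl !IstructP mulrDr.
  by rewrite mulrCA.
- apply: (Psi_inj (x := x)) => z; rewrite !IstructP mulrA sqr_i (two_formNl tP).
  by rewrite mulN1r.
have /two_formP[[b1 _ s1] [b2 _ s2]] := tP.
set J := (fun p => _).
(* [Re Psi(I u, v) = - Im Psi(u, v)] is a linear system for [I u] with smooth coefficients and an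
   invertible matrix; Cramer's rule gives smoothness. *)
have JP p v : ccod c p -> rcoef (rePart Psi) c (J p) v p = - rcoef (imPart Psi) c u v p.
  move=> cp; rewrite /rcoef /J cinv_pdiffK// /rePart IstructP ReI//.
pose r p : 'rV[R]_(2 * n + 2 * n) := \row_j (- rcoef (imPart Psi) c u (be R j) p).
have uP p : ccod c p -> rmx (rePart Psi) c p \in unitmx.
  by move=> cp; apply: rmx_unit => //; exact: re_Psi_nondegenerate.
have JE p : ccod c p -> flat (J p) = r p *m invmx (rmx (rePart Psi) c p).
  move=> cp; rewrite -[LHS](mulmxK (uP p cp)); congr (_ *m _).
  apply/rowP => j; rewrite [RHS]mxE -(JP p _ cp) (rmxP c b1).
  rewrite /be unflatK trmx_delta -colE [RHS]mxE//.
move=> k.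
have oc := @ccod_open _ _ _ c.
apply: Ck_on_coP => // i.
apply: (@Ck_on_eq _ _ _ _ _ (fun p => \sum_j (- rcoef (imPart Psi) c u (be R j) p) *
   invmx (rmx (rePart Psi) c p) j i)) => //.
  move=> p cp; rewrite /= /co JE// [RHS]mxE; apply: eq_bigr => j _.
  by rewrite [r p _ _]mxE.
apply: Ck_on_sum => // j _; apply: Ck_onM => //.
  by apply: Ck_onN => //; exact: s2.
apply: Ck_on_invmx => // a b.
apply: (@Ck_on_eq _ _ _ _ _ (rcoef (rePart Psi) c (be R a) (be R b))) => //.
  by move=> p _; rewrite mxE.
exact: s1.
Qed.

Lemma Istruct_induced : induced_structure Psi Istruct.
Proof.
split; [exact: Istruct_acs|by move=> x u v; exact: IstructP|exact: Psi_nondegenerate].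
Qed.

Lemma induced_unique I' : induced_structure Psi I' -> forall x u, I' x u = Istruct x u.
Proof.
move=> [_ t20 _] x u; apply: (Psi_inj (x := x)) => v.
by rewrite IstructP; exact: t20.
Qed.

(** * The section in the new structure *)

Lemma Psi_section b u v : Psi (S b) (mdiff S b u) (mdiff S b v) = 0.
Proof.
by rewrite /Psi /pullback /eta !mdiff_section hsection /pullback subrr.
Qed.

(** Both sides are compared under [Psi] against [v], split into a vector tangent to the section and
    a vertical one [k]. The first contributes 0. Against [k] the form is [Omega], and
    [dS (J u) - J (dS u)] is vertical, so isotropy of the fibre at [S b] concludes. *)
Lemma section_holomorphic : holomorphic_to Istruct S.
Proof.
split=> // b u; apply: (Psi_inj (x := S b)) => v; rewrite IstructP.
have [_ iso] := section_fibre b.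
pose w := mdiff pi (S b) v; pose k := v - mdiff S b w.
have pk : mdiff pi (S b) k = 0.
  by rewrite /k (lin_funB (mdiff_lin _ _)) mdiff_section subrr.
have vE : v = mdiff S b w + k by rewrite /k addrC subrK.
have Pk a : Psi (S b) a k = Omega (S b) a k by rewrite /Psi /pullback pk eta0r addr0.
have PsiD a z z' : Psi (S b) a (z + z') = Psi (S b) a z + Psi (S b) a z'.
  by case: Psi_two_form => _ pr _ _; rewrite -[z in LHS]scale1r pr mul1r.
have PE z : Psi (S b) z v = Psi (S b) z (mdiff S b w) + Psi (S b) z k.
  by rewrite -PsiD -vE.
rewrite !PE !Psi_section !add0r !Pk -O20.
pose a := mdiff S b (mulI u) + - mulI (mdiff S b u).
have pa : mdiff pi (S b) a = 0.
  by rewrite /a (lin_funB (mdiff_lin _ _)) piJ !mdiff_section subrr.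
have := iso _ _ pa pk; rewrite /a Ol (two_formNl tO) => /eqP.
by rewrite subr_eq0 => /eqP.
Qed.

Lemma section_local_param b : exists (W : set (Cn R m)) (g : Cn R m -> M),
  local_param (range S) W g /\ (exists2 p, W p & g p = S b).
Proof.
pose c := chart_at b; have ac : atlas c := chart_at_atlas b.
have cb : cdom c b := chart_at_dom b.
exists (ccod c), (S \o cinv c); split; last first.
  by exists (cmap c b); [exact: cmap_cod|rewrite /= cmapK].
have pE p u : ccod c p -> mdiff pi (S (cinv c p)) (pdiff (S \o cinv c) p u) = pdiff (cinv c) p u.
  move=> cp; have [_ E] := chain_rule hS (cinv_mdiff ac cp).
  have E2 := congr1 (@^~ u) E.
  have E3 := congr1 (mdiff pi (S (cinv c p))) E2.
  have E4 := etrans E3 (mdiff_section (cinv c p) (pdiff (cinv c) p u)).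
  exact: E4.
split.
- exact: ccod_open.
- exact: hS.
- move=> p q cp cq /= E.
  by rewrite -(cinvK cp) -(cinvK cq) -[cinv c p]hsection -[cinv c q]hsection E.
- move=> p cp u v E; apply: (pdiff_cinv_inj ac cp).
  have E1 := congr1 (mdiff pi (S (cinv c p))) E.
  have E2 := etrans (esym (pE p u cp)) (etrans E1 (pE p v cp)).
  exact: E2.
(* The image of the section meets the [pi]-preimage of a subset of the base exactly in the image of
   that subset under [S]. *)
- move=> W' oW' W'W; exists (pi @^-1` (cinv c @` W')).
    apply: open_comp; first by move=> x _; exact: (smooth_map_continuous spi).
    by rewrite cinv_open//; exact: open_chart.
  apply/seteqP; split=> [_ [p W'p <-]|_ [[b' _ <-] [p W'p pb]]].
    split; first by exists (cinv c p).
    by exists p => //; rewrite /= hsection.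
  by exists p => //=; rewrite pb hsection.
Qed.

(** Any local parametrization [g] of the image satisfies [g = S o pi o g], so the pullback of [Psi]
    by [g] factors through its pullback by [S], which is zero. *)
Lemma section_lagrangian : lagrangian_submanifold Psi (range S).
Proof.
split.
  move=> _ [b _ <-]; have [mn _] := section_fibre b.
  (* The parametrization at hand has dimension m; generalizing the target dimension allows the
     transport along [m = n]. *)
  have K : forall k, m = k -> exists (W : set (Cn R k)) (g : Cn R k -> M),
      local_param (range S) W g /\ (exists2 p, W p & g p = S b).
    by move=> k <-; exact: section_local_param.
  exact: K mn.
move=> W g [oW sg _ _ himg] p Wp u v.
have rangeS q : W q -> S (pi (g q)) = g q.
  move=> Wq; have [U _ E] := himg W oW (fun _ => id).
  have : (g @` W) (g q) by exists q.
  by rewrite E => -[[b _ <-] _]; rewrite hsection.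
have mg := smooth_from_mdiff sg Wp.
have [mpg _] := chain_rule spi mg.
have [_ E] := chain_rule hS mpg.
have H : \forall q \near p, g q = (S \o (pi \o g)) q.
  by apply: filterS (open_nbhs_nbhs (conj oW Wp)) => q /rangeS H; exact: esym H.
have E2 := etrans (near_eq_pdiff H mg) E.
rewrite /ppullback E2 -(rangeS p Wp) /=.
exact: Psi_section.
Qed.

End Main.

Theorem theorem1p2 (R : realType) (n m : nat)
    (M : complexManifold R (2 * n)) (B : complexManifold R m)
    (Omega : tensor2 M) (pi : M -> B) (S : B -> M)
    (hOmega : holomorphic_symplectic Omega)
    (hpi : lagrangian_fibration Omega pi)
    (hS : smooth_map S)
    (hsection : forall b, pi (S b) = b) :
  exists eta : tensor2 B,
    [/\ two_form eta, closed_form eta, type20_11 eta &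
      let Psi : tensor2 M :=
        fun x u v => Omega x u v + pullback pi eta x u v in
      exists I : M -> Cn R (2 * n) -> Cn R (2 * n),
        [/\ induced_structure Psi I,
            (forall I', induced_structure Psi I' -> forall x u, I' x u = I x u),
            holomorphic_to I S &
            lagrangian_submanifold Psi (range S)]].
Proof.
exists (eta Omega S); split.
- exact: eta_two_form.
- exact: eta_closed.
- by apply: type20_11_intro; [exact: eta_two_form|exact: (eta_no02 hOmega hpi hS hsection)].
exists (Istruct Omega pi S); split.
- exact: Istruct_induced.
- exact: induced_unique.
- exact: section_holomorphic.
- exact: section_lagrangian.
Qed.
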